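(* Let $n\ge1$ and $w\in\Sigma_{0,1,n}$. Then $w$ lies in the $\mathcal{B}_n$-orbit $\{t_1^\phi:\phi\in\mathcal{B}_n\}$ of $t_1$ if and only if both of the following hold: - the cyclically reduced form of $w$ lies in $\{t_1,\dots,t_n\}$; - $w$ is a planar word.
   Context: $\Sigma_{0,1,n}$ is the free group on $t_1,\dots,t_n$, with $\overline t_k=t_k^{-1}$ and $z_1=(t_1\cdots t_n)^{-1}$. Automorphisms act on the right as exponents. $\mathcal{B}_n$ is the group of automorphisms of $\Sigma_{0,1,n}$ fixing $z_1$ and permuting the conjugacy classes $\{[t_1],\dots,[t_n]\}$. Let $A$ be the set of formal symbols $\overline z_1,t_1,\overline t_1,\dots,t_n,\overline t_n,z_1$, ordered by $\overline z_1<t_1<\overline t_1<\dots<t_n<\overline t_n<z_1$. For a reduced word $a_1\cdots a_m$, its Whitehead expansion is $(c_1,\dots,c_{2m+2})=(\overline z_1,a_1,\overline a_1,\dots,a_m,\overline a_m,z_1)$. Two $2$-element sets of integers $\{a,b\},\{c,d\}$ are nested if $a,b,c,d$ are distinct and either both or neither of $c,d$ lie strictly between $a$ and $b$. A $2M$-tuple $(c_1,\dots,c_{2M})$ of elements of $A$ is planar if some permutation $\pi$ of $\{1,\dots,2M\}$ satisfies three conditions: - $\pi(i)<\pi(j)\Rightarrow c_i\le c_j$; - the sets $\{\pi(2i-1),\pi(2i)\}$, $1\le i\le M$, are pairwise nested; - the sets $\{\pi(2i),\pi(2i+1)\}$, $1\le i\le M-1$, are pairwise nested. A word $w$ is planar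 if the Whitehead expansion of its reduced word is planar. *)

(* Defs.v *)
(* Free group Sigma_{0,1,n} = F(t_1..t_n), elements = reduced words. *)
From mathcomp Require Import all_boot all_fingroup.
Set Implicit Arguments. Unset Strict Implicit. Unset Printing Implicit Defensive.

Section FreeGroup.
Variable n : nat.

(* letter (i, true) = t_{i+1};  (i, false) = t_{i+1}^{-1}  (0-based index i : 'I_n) *)
Definition letter := ('I_n * bool)%type.
Definition word := seq letter.

Definition linv (x : letter) : letter := (x.1, ~~ x.2).
Definition winv (w : word) : word := rev (map linv w).

Definition reduced (w : word) : bool := sorted (fun x y => y != linv x) w.

Definition reduce (w : word) : word :=
  foldr (fun x acc => match acc with
                      | y :: acc' => if y == linv x then acc' else x :: acc
                      | [::] => [:: x] end) [::] w.

(* the endomorphism of the free group sending t_i to f i (right action: w^phi) *)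
Definition ext (f : 'I_n -> word) (w : word) : word :=
  reduce (flatten (map (fun x => if x.2 then f x.1 else winv (f x.1)) w)).

Definition gen (i : 'I_n) : word := [:: (i, true)].

Definition z1 : word := winv (map (fun i => (i, true)) (enum 'I_n)).

Definition conjugate (u v : word) : Prop :=
  exists g : word, reduced g /\ reduce (winv g ++ u ++ g) = v.

Definition is_aut (f : 'I_n -> word) : Prop :=
  (forall u v, reduced u -> reduced v -> ext f u = ext f v -> u = v) /\
  (forall v, reduced v -> exists u, reduced u /\ ext f u = v).

Definition in_Bn (f : 'I_n -> word) : Prop :=
  [/\ is_aut f, ext f z1 = z1 &
      exists s : 'S_n, forall i, conjugate (ext f (gen i)) (gen (s i))].

Fixpoint cred (k : nat) (w : word) : word :=
  match k with
  | 0 => w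
  | k'.+1 => match w with
             | [::] => w
             | x :: r => if (r != [::]) && (last x r == linv x)
                         then cred k' (behead (belast x r)) else w
             end
  end.
Definition cyc_red (w : word) : word := cred (size w) w.

(* the ordered alphabet A encoded by ranks:
   zbar_1 = 0, t_i = 2i-1, tbar_i = 2i, z_1 = 2n+1 (i 1-based) *)
Definition rank (x : letter) : nat := if x.2 then (2 * x.1).+1 else (2 * x.1).+2.
Definition zbar_rank : nat := 0.
Definition z_rank : nat := (2 * n).+1.

Definition whitehead (w : word) : seq nat :=
  zbar_rank :: flatten (map (fun x => [:: rank x; rank (linv x)]) w) ++ [:: z_rank].

End FreeGroup.

Definition nested (a b c d : nat) : bool :=
  let btw x := (minn a b < x) && (x < maxn a b) in
  uniq [:: a; b; c; d] && (btw c == btw d).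

(* planarity of a 2M-tuple c (positions 0-based; pi given as a list p,
   pi(k) = nth 0 p k, a permutation of {0,...,2M-1}) *)
Definition planar (c : seq nat) : Prop :=
  let N := size c in let M := N./2 in
  exists p : seq nat,
    [/\ perm_eq p (iota 0 N),
        (forall i j, i < N -> j < N -> nth 0 p i < nth 0 p j ->
                     nth 0 c i <= nth 0 c j),
        (forall i j, i < M -> j < M -> i != j ->
           nested (nth 0 p (2*i)) (nth 0 p (2*i).+1)
                  (nth 0 p (2*j)) (nth 0 p (2*j).+1)) &
        (forall i j, i < M.-1 -> j < M.-1 -> i != j ->
           nested (nth 0 p (2*i).+1) (nth 0 p (2*i).+2)
                  (nth 0 p (2*j).+1) (nth 0 p (2*j).+2))].

Definition planar_word (n : nat) (w : word n) : Prop := planar (whitehead (reduce w)).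

(* Main.v *)
Require Import Defs.
From mathcomp Require Import all_boot all_fingroup zify.
Set Implicit Arguments. Unset Strict Implicit. Unset Printing Implicit Defensive.

(** The lifts of the boundary base point to the universal cover of the punctured
disc are indexed by the free group [F] and lie on its boundary circle, so [F]
carries a left-invariant cyclic order.  A word [w] is planar exactly when the arc
from [1] to [w] is unlinked from all its translates: sorting the endpoints of the
translates that pass through the tile of [1] is the permutation in the definition.

Braid automorphisms preserve the cyclic order.  This is checked on the standard
generators; Artin's argument (some Hurwitz move shortens any nontrivial
factorisation of [t_1 ... t_n] into conjugates of generators) reduces every
element of [B_n] to them.  Hence the orbit of [t_1] consists of planar words.

Conversely let [w = u^-1 t_i u] be planar, i.e. the boundary of a neighbourhood of
a simple arc [u] from the puncture [i] to the base point.  Sliding the puncture [i]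
along [u] across the first ray that [u] meets lowers the number of letters of [u]
different from [t_i^{+-1}]: the crossings of [u] with the ray of [i] itself are not
counted, so it does not matter how that ray is redrawn. *)

(** * Free groups of reduced words *)

(** A translate of the arc may start at the very base point where another one ends. Each base point
    is therefore doubled into a point just after it and a point just before it. The two copies of
    the trivial word carry the symbols of rank [0] and [z_rank], which explains the two extra
    entries of the Whitehead expansion. Reduced words are compared at the first letter where they
    differ, in the cyclic order of the alphabet cut open at the inverse of the last common letter:
    that is the one letter that cannot come next.

    The obstacle in the converse is that sliding a puncture across a ray substitutes [a b a^-1] for
    [a], where [a] is [t_i] or [t_i^-1], and could lengthen the word. The two arcs that meet at the
    central letter of [u^-1 t_i u] have adjacent ends, and no other arc can pass between adjacent
    points. This forces every [a] in the word to be followed by the first letter [b] of [u], and the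
    product [a b] is fixed by the substitution that sends [b] to [a]. *)

Section FreeGroup.
Variable n : nat.
Implicit Types (x y z u v w : word n) (a b : letter n).

Lemma linvK : involutive (@linv n).
Proof. by case=> i b; rewrite /linv /= negbK. Qed.

Lemma linv_neq a : (linv a == a) = false.
Proof. by case: a => i [] /=; apply/eqP => -[]. Qed.

Lemma linv_eq a b : (linv a == b) = (a == linv b).
Proof. by apply/eqP/eqP => [<-|->]; rewrite linvK. Qed.

Definition push a x : word n :=
  if x is b :: x' then if b == linv a then x' else a :: x else [:: a].

Lemma reduce_cons a x : reduce (a :: x) = push a (reduce x).
Proof. by []. Qed.

Lemma reduced_behead a x : reduced (a :: x) -> reduced x.
Proof. exact: path_sorted. Qed.

Lemma reduced_cons2 a b x :
  reduced (a :: b :: x) = (b != linv a) && reduced (b :: x).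
Proof. by []. Qed.

Lemma reduced_push a x : reduced x -> reduced (push a x).
Proof.
case: x => [|b x] //= h; case: ifP => [_|/negbT ne]; first exact: path_sorted h.
by rewrite /= ne.
Qed.

Lemma push_reduced a x : reduced (a :: x) -> push a x = a :: x.
Proof. by case: x => [|b x] //= /andP[/negbTE -> _]. Qed.

Lemma pushK a x : reduced x -> push (linv a) (push a x) = x.
Proof.
case: x => [|b x] /=; first by rewrite linvK eqxx.
case: (b =P linv a) => [->|_] h; first exact: push_reduced.
by rewrite /= linvK eqxx.
Qed.

Lemma reduced_reduce x : reduced (reduce x).
Proof. by elim: x => // a x IH; apply: reduced_push. Qed.

Lemma reduce_id x : reduced x -> reduce x = x.
Proof.
elim: x => // a x IH h; rewrite reduce_cons IH ?push_reduced //.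
exact: reduced_behead h.
Qed.

Lemma reduce_cat x y : reduce (x ++ y) = foldr push (reduce y) x.
Proof. exact: foldr_cat. Qed.

(** The maps [push a] act on reduced words, with [push (linv a)] inverse to [push a], so a
    cancelling pair inside a word acts trivially. This takes the place of a confluence argument for
    [reduce]. *)
Lemma foldr_push_push a z x :
  reduced z -> foldr push z (push a x) = push a (foldr push z x).
Proof.
move=> hz; case: x => [|b x] //=; case: (b =P linv a) => [->|_] //=.
rewrite -{1}(linvK a) pushK //.
by elim: x => //= b' x IH; apply: reduced_push.
Qed.

Lemma reduce_catl x y : reduce (reduce x ++ y) = reduce (x ++ y).
Proof.
elim: x => // a x IH; rewrite reduce_cons reduce_cat foldr_push_push.
  by rewrite -reduce_cat IH.
exact: reduced_reduce.
Qed.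

Lemma reduce_catr x y : reduce (x ++ reduce y) = reduce (x ++ y).
Proof. by rewrite !reduce_cat (reduce_id (reduced_reduce y)). Qed.

Definition eqv x y := reduce x = reduce y.

Lemma eqv_cat x x' y y' : eqv x x' -> eqv y y' -> eqv (x ++ y) (x' ++ y').
Proof.
by rewrite /eqv => hx hy; rewrite -reduce_catl -reduce_catr hx hy reduce_catl reduce_catr.
Qed.

Lemma eqv_reduce x : eqv (reduce x) x.
Proof. exact: reduce_id (reduced_reduce x). Qed.

Lemma winv_cat x y : winv (x ++ y) = winv y ++ winv x.
Proof. by rewrite /winv map_cat rev_cat. Qed.

Lemma winv_cons a x : winv (a :: x) = winv x ++ [:: linv a].
Proof. by rewrite -cat1s winv_cat. Qed.

Lemma winvK x : winv (winv x) = x.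
Proof. by rewrite /winv map_rev revK mapK //; exact: linvK. Qed.

Lemma size_winv x : size (winv x) = size x.
Proof. by rewrite size_rev size_map. Qed.

Lemma reduce_winvl x y : reduce (winv x ++ x ++ y) = reduce y.
Proof.
elim: x y => // a x IH y; rewrite winv_cons -catA /= -reduce_catr.
rewrite -(IH y) -[RHS]reduce_catr; congr reduce; congr (_ ++ _).
by rewrite reduce_cons reduce_cons pushK //; exact: reduced_reduce.
Qed.

Lemma reduce_winvr x y : reduce (x ++ winv x ++ y) = reduce y.
Proof. by rewrite -{1}(winvK x) reduce_winvl. Qed.

Lemma reduce_mulI x y z : reduce (x ++ y) = reduce (x ++ z) -> reduce y = reduce z.
Proof.
move=> h; rewrite -(reduce_winvl x y) -(reduce_winvl x z).
by rewrite -reduce_catr h reduce_catr.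
Qed.

Lemma eqv_winv x y : eqv x y -> eqv (winv x) (winv y).
Proof.
move=> h; apply: (@reduce_mulI x).
transitivity (@reduce n [::]); first by rewrite -(cats0 (x ++ _)) -catA reduce_winvr.
rewrite -reduce_catl h reduce_catl.
by rewrite -(cats0 (y ++ _)) -catA reduce_winvr.
Qed.

Lemma reduced_winv x : reduced (winv x) = reduced x.
Proof.
rewrite /reduced /winv rev_sorted; case: x => //= a x.
rewrite path_map; apply: eq_path => b c /=.
by rewrite (inj_eq (can_inj linvK)) eq_sym linv_eq.
Qed.

(** Substitution without reduction is an exact monoid morphism; all cancellation is postponed to
    [eqv]. *)
Definition subw (f : 'I_n -> word n) x : word n :=
  flatten (map (fun a : letter n => if a.2 then f a.1 else winv (f a.1)) x).

Lemma extE f x : ext f x = reduce (subw f x).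
Proof. by []. Qed.

Lemma subw_cat f x y : subw f (x ++ y) = subw f x ++ subw f y.
Proof. by rewrite /subw map_cat flatten_cat. Qed.

Lemma subw_cons f a x : subw f (a :: x) = subw f [:: a] ++ subw f x.
Proof. by rewrite -subw_cat. Qed.

Lemma subw1V f a : subw f [:: linv a] = winv (subw f [:: a]).
Proof. by case: a => i [] /=; rewrite /subw /= !cats0 ?winvK. Qed.

Lemma subw_winv f x : subw f (winv x) = winv (subw f x).
Proof.
elim: x => // a x IH.
by rewrite winv_cons subw_cat (subw_cons f a) winv_cat IH subw1V.
Qed.

Lemma subw_gen f i : subw f (gen i) = f i.
Proof. by rewrite /subw /= cats0. Qed.

Lemma subw_push f a x : eqv (subw f (push a x)) (subw f (a :: x)).
Proof.
case: x => [|b x] //=; case: eqP => [->|_] //.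
rewrite /eqv (subw_cons f a) (subw_cons f (linv a) x) subw1V.
by rewrite reduce_winvr.
Qed.

Lemma subw_reduce f x : eqv (subw f (reduce x)) (subw f x).
Proof.
elim: x => // a x IH; rewrite reduce_cons /eqv subw_push.
by rewrite (subw_cons f a) (subw_cons f a x); apply: eqv_cat.
Qed.

Lemma ext_reduce f x : ext f (reduce x) = ext f x.
Proof. exact: subw_reduce. Qed.

Lemma ext_cat f x y : ext f (x ++ y) = reduce (ext f x ++ ext f y).
Proof. by rewrite !extE reduce_catl reduce_catr subw_cat. Qed.

Lemma ext_winv f x : ext f (winv x) = reduce (winv (ext f x)).
Proof. by rewrite !extE subw_winv; apply/esym/eqv_winv/eqv_reduce. Qed.

Lemma reduced_ext f x : reduced (ext f x).
Proof. exact: reduced_reduce. Qed.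

Definition compw (f g : 'I_n -> word n) : 'I_n -> word n := fun i => ext g (f i).

Lemma subw_compw f g x : eqv (subw (compw f g) x) (subw g (subw f x)).
Proof.
elim: x => // a x IH.
rewrite (subw_cons _ a) (subw_cons f a) subw_cat; apply: eqv_cat => //.
case: a => i [] /=; rewrite /subw /= !cats0; first exact: eqv_reduce.
rewrite -![flatten _]/(subw _ _) subw_winv; apply: eqv_winv; exact: eqv_reduce.
Qed.

Lemma ext_compw f g x : ext (compw f g) x = ext g (ext f x).
Proof. by rewrite !extE subw_compw -[RHS]/(ext g _) ext_reduce. Qed.

Lemma subw_genid x : subw (@gen n) x = x.
Proof. by elim: x => // -[i []] x IH; rewrite subw_cons IH. Qed.

Lemma ext_eqf f g x : (forall i, eqv (f i) (g i)) -> ext f x = ext g x.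
Proof.
move=> h; rewrite !extE; elim: x => // -[i b] x IH.
rewrite (subw_cons f) (subw_cons g); apply: eqv_cat => //.
by case: b; rewrite /subw /= !cats0 //; apply: eqv_winv.
Qed.

End FreeGroup.

(** * The cyclic order on the base points of the universal cover *)

Arguments rank : simpl never.
Arguments linv : simpl never.

Section Order.
Variable n : nat.
Implicit Types (x y z u v w : word n) (a b : letter n).

(* [(x, true)] lies immediately after the base point [x] (an arc leaves [x] there)
   and [(x, false)] immediately before it (an arc arrives there). *)
Definition point : Type := word n * bool.
Implicit Types (p q r : point).

Lemma rank_gt0 a : 0 < rank a.
Proof. by rewrite /rank; case: ifP. Qed.

Lemma rank_lt a : rank a < (2 * n).+1.
Proof. by rewrite /rank; have := ltn_ord a.1; case: ifP => _; lia. Qed.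

Lemma rank_inj : injective (@rank n).
Proof.
move=> [i b] [j c]; rewrite /rank /=; move=> h.
have eij : i = j by apply: val_inj; move: h; case: b; case: c => /=; lia.
by subst j; congr pair; move: h; case: b; case: c => //=; lia.
Qed.

Definition hsym p : nat :=
  if p.1 is a :: _ then rank a else if p.2 then 0 else z_rank n.

Lemma hsym_lt p : hsym p < (2 * n).+2.
Proof.
by case: p => [[|a x] []]; rewrite /hsym /z_rank //=; have := rank_lt a; lia.
Qed.

Lemma hsym_rank a p : hsym p = rank a -> p.1 = a :: behead p.1.
Proof.
case: p => [[|b x] e]; rewrite /hsym /z_rank /=.
  by case: e; have := rank_gt0 a; have := rank_lt a; lia.
by move/rank_inj=> ->.
Qed.

(* Position of the symbol [s] in the cyclic order of the alphabet cut open at [c]. *)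
Definition key (c s : nat) : nat := if c <= s then s - c else s + (2 * n).+2 - c.

(* After a common letter [a] the order is cut at the symbol [linv a], the direction
   one comes from. *)
Fixpoint lt_rec (c : nat) x (e : bool) y (f : bool) : bool :=
  match x, y with
  | a :: x', b :: y' =>
    if a == b then lt_rec (rank (linv a)) x' e y' f
    else key c (rank a) < key c (rank b)
  | _, _ => key c (hsym (x, e)) < key c (hsym (y, f))
  end.

Definition lt c p q := lt_rec c p.1 p.2 q.1 q.2.

Lemma lt_cons c a x e y f :
  lt c (a :: x, e) (a :: y, f) = lt (rank (linv a)) (x, e) (y, f).
Proof. by rewrite /lt /= eqxx. Qed.

Lemma lt_neq c p q : hsym p != hsym q -> lt c p q = (key c (hsym p) < key c (hsym q)).
Proof.
case: p q => [[|a x] e] [[|b y] f] //= h; rewrite /lt /=.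
by case: eqP => [E|//]; move: h; rewrite /hsym /= E eqxx.
Qed.

Lemma lt_eq c d p q : hsym p = hsym q -> lt c p q = lt d p q.
Proof.
case: p q => [[|a x] e] [[|b y] f] h; rewrite /lt /= ?h ?ltnn //.
by move/rank_inj: h => ->; rewrite eqxx.
Qed.

Lemma lt_irr c p : lt c p p = false.
Proof.
case: p => x e; elim: x c => [|a x IH] c; first by rewrite /lt /= ltnn.
by rewrite lt_cons.
Qed.

Lemma key_inj c s t : c < (2 * n).+2 -> s < (2 * n).+2 -> t < (2 * n).+2 ->
  key c s = key c t -> s = t.
Proof. rewrite /key; case: ifP => ?; case: ifP => ?; lia. Qed.

Lemma lt_trans c q p r : c < (2 * n).+2 -> lt c p q -> lt c q r -> lt c p r.
Proof.
case: p q r => [x e] [y f] [z g]; elim: x y z c => [|a x IH] y z c hc.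
  case: (hsym ([::], e) =P hsym (y, f)) => [E|/eqP N].
    case: y E => [|b y] E; first by rewrite /lt /= E ltnn.
    by move: E; rewrite /hsym /z_rank /=; case: e; have := rank_gt0 b; have := rank_lt b; lia.
  rewrite (lt_neq _ N); case: (hsym (y, f) =P hsym (z, g)) => [E|/eqP N'].
    by rewrite E => h1 h2; rewrite lt_neq // -E.
  rewrite (lt_neq _ N') => h1 h2; have h3 := ltn_trans h1 h2.
  by rewrite lt_neq //; apply/eqP => E; rewrite E ltnn in h3.
have hl := rank_lt (linv a).
case: (hsym (a :: x, e) =P hsym (y, f)) => [E|/eqP N].
  have /= Ey := hsym_rank (esym E); rewrite Ey.
  move: (behead y) => y1; rewrite lt_cons.
  case: (hsym (a :: y1, f) =P hsym (z, g)) => [E'|/eqP N'].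
    have /= -> := hsym_rank (esym E'); rewrite !lt_cons.
    by apply: IH; lia.
  by rewrite !(@lt_neq _ (a :: _, _)) // => _.
rewrite (lt_neq _ N); case: (hsym (y, f) =P hsym (z, g)) => [E|/eqP N'].
  by rewrite E => h1 h2; rewrite lt_neq // -E.
rewrite (lt_neq _ N') => h1 h2; have h3 := ltn_trans h1 h2.
by rewrite lt_neq //; apply/eqP => E; rewrite E ltnn in h3.
Qed.

Lemma lt_asym c p q : c < (2 * n).+2 -> lt c p q -> lt c q p = false.
Proof.
by move=> hc h; apply/negP => h'; have := lt_trans hc h h'; rewrite lt_irr.
Qed.

Lemma lt_total c p q : c < (2 * n).+2 -> p != q -> lt c p q || lt c q p.
Proof.
case: p q => [x e] [y f]; elim: x y c => [|a x IH] y c hc ne.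
  case: (hsym ([::], e) =P hsym (y, f)) => [E|/eqP N].
    case: y E ne => [|b y]; rewrite /hsym /z_rank /=.
      by case: e; case: f.
    by case: e; have := rank_gt0 b; have := rank_lt b; lia.
  rewrite (lt_neq _ N); rewrite eq_sym in N; rewrite (lt_neq _ N) -neq_ltn eq_sym; apply: contraNN N => /eqP /key_inj -> //; exact: hsym_lt.
case: (hsym (a :: x, e) =P hsym (y, f)) => [E|/eqP N].
  have /= Ey := hsym_rank (esym E); rewrite Ey in ne *; rewrite !lt_cons.
  apply: IH; first by have := rank_lt (linv a); lia.
  by apply: contra ne => /eqP [-> ->].
rewrite (lt_neq _ N); rewrite eq_sym in N; rewrite (lt_neq _ N) -neq_ltn eq_sym; apply: contraNN N => /eqP /key_inj -> //; exact: hsym_lt.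
Qed.

Lemma lt_hsym p q : lt 0 p q -> hsym p <= hsym q.
Proof.
case: (hsym p =P hsym q) => [->//|/eqP N]; rewrite lt_neq // /key /= !subn0.
exact: ltnW.
Qed.

Lemma lt_of_hsym p q : hsym p < hsym q -> lt 0 p q.
Proof. by move=> h; rewrite lt_neq ?neq_ltn ?h // /key /= !subn0. Qed.

Definition cyc c p q r : bool :=
  [|| lt c p q && lt c q r, lt c q r && lt c r p | lt c r p && lt c p q].

Lemma cyc_rot c p q r : cyc c p q r = cyc c q r p.
Proof. by rewrite /cyc; case: (lt c p q); case: (lt c q r); case: (lt c r p). Qed.

Lemma key_lt c s t : c < (2 * n).+2 -> s < (2 * n).+2 -> t < (2 * n).+2 ->
  (key c s < key c t) = if (c <= s) == (c <= t) then s < t else c <= s.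
Proof.
move=> hc hs ht; rewrite /key.
by case: (leqP c s) => h1; case: (leqP c t) => h2 /=; lia.
Qed.

(** Moving the cut only rotates the first symbols. Points with the same first symbol are compared
    further down, where [c] no longer enters. *)
Lemma cyc_cut c p q r : c < (2 * n).+2 -> cyc c p q r = cyc 0 p q r.
Proof.
move=> hc; rewrite /cyc.
have hp := hsym_lt p; have hq := hsym_lt q; have hr := hsym_lt r.
case: (hsym p =P hsym q) => [E1|/eqP N1]; case: (hsym q =P hsym r) => [E2|/eqP N2].
- have E3 := etrans (esym E2) (esym E1).
  by rewrite !(@lt_eq c 0).
- have N3 : hsym r != hsym p by rewrite E1 eq_sym.
  rewrite (@lt_eq c 0 p) // !(lt_neq _ N2) !(lt_neq _ N3) -E1 !key_lt // !leq0n eqxx.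
  rewrite -E1 in N2; case: (lt 0 p q); rewrite ?andbT ?andbF ?orbF /=;
  by case: (leqP c (hsym p)) => h1; case: (leqP c (hsym r)) => h2 /=; lia.
- have N3 : hsym r != hsym p by rewrite -E2 eq_sym.
  rewrite (@lt_eq c 0 q) // !(lt_neq _ N1) !(lt_neq _ N3) -E2 !key_lt // !leq0n eqxx.
  case: (lt 0 q r); rewrite ?andbT ?andbF ?orbF /=;
  by case: (leqP c (hsym p)) => h1; case: (leqP c (hsym q)) => h2 /=; lia.
case: (hsym r =P hsym p) => [E3|/eqP N3].
  rewrite (@lt_eq c 0 r) // !(lt_neq _ N1) !(lt_neq _ N2) E3 !key_lt // !leq0n eqxx.
  case: (lt 0 r p); rewrite ?andbT ?andbF ?orbF /=;
  by case: (leqP c (hsym p)) => h1; case: (leqP c (hsym q)) => h2 /=; lia.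
rewrite !(lt_neq _ N1) !(lt_neq _ N2) !(lt_neq _ N3) !key_lt // !leq0n eqxx.
move: (hsym p) (hsym q) (hsym r) N1 N2 N3 {hp hq hr} => s t v N1 N2 N3.
by case: (leqP c s) => h1; case: (leqP c t) => h2; case: (leqP c v) => h3 /=; lia.
Qed.

(** Cutting the circle at the symbol of [p] makes [p] the least of the three points. *)
Lemma cyc_first p q r : hsym q != hsym p -> hsym r != hsym p ->
  cyc 0 p q r = lt (hsym p) q r.
Proof.
move=> N1 N2; have hp := hsym_lt p; have hq := hsym_lt q; have hr := hsym_lt r.
rewrite -(cyc_cut _ _ _ hp) /cyc.
have -> : lt (hsym p) p q by rewrite lt_neq 1?eq_sym // /key; case: ifP; case: ifP; lia.
have -> : lt (hsym p) r p = false by rewrite lt_neq // /key; case: ifP; case: ifP; lia.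
by rewrite andbF !orbF.
Qed.

Lemma cyc_outside p q r : hsym q = hsym r -> hsym q != hsym p -> cyc 0 p q r = lt 0 q r.
Proof.
by move=> E N; rewrite cyc_first -?E //; apply: lt_eq.
Qed.

Lemma cyc_base q r : hsym q != 0 -> hsym r != 0 -> cyc 0 ([::], true) q r = lt 0 q r.
Proof. by move=> hq hr; rewrite cyc_first. Qed.

Definition pushp a p : point := (push a p.1, p.2).

Lemma hsym_pushp a p : hsym p != rank (linv a) -> hsym (pushp a p) = rank a.
Proof.
by case: p => [[|b x] e] //=; rewrite /hsym /=; case: (b =P linv a) => [->|//]; rewrite eqxx.
Qed.

Lemma pushp_cons a p : hsym p != rank (linv a) -> pushp a p = (a :: p.1, p.2).
Proof.
by case: p => [[|b x] e] //=; rewrite /pushp /hsym /=; case: (b =P linv a) => [->|//]; rewrite eqxx.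
Qed.

Lemma hsym_reduced a x e : reduced (a :: x) -> hsym (x, e) != rank (linv a).
Proof.
case: x => [_|b x /andP[h _]]; rewrite /hsym /=.
  by case: e; have := rank_gt0 (linv a); have := rank_lt (linv a); rewrite /z_rank; lia.
by apply: contra h => /eqP /rank_inj ->.
Qed.

(** Multiplication by [a] carries the cone of [linv a] onto the complement of the cone of [a], and
    the rest into the cone of [a], where the order is cut at [linv a], the place just vacated. Up to
    rotation only the number of points in the cone of [linv a] matters; [one] and [two] are the
    mixed cases. *)
Lemma cyc_pushp a p q r : reduced p.1 -> reduced q.1 -> reduced r.1 ->
  cyc 0 (pushp a p) (pushp a q) (pushp a r) = cyc 0 p q r.
Proof.
have hA b : rank b < (2 * n).+2 by have := rank_lt b; lia.
have caseH p' : reduced p'.1 -> hsym p' = rank (linv a) ->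
   exists2 x, p' = (linv a :: x, p'.2) & pushp a p' = (x, p'.2) /\ hsym (x, p'.2) != rank a.
  case: p' => y e /= hr E; have /= Ey := hsym_rank E; exists (behead y); rewrite -?Ey //.
  rewrite Ey in hr *; rewrite /pushp /= eqxx; split=> //.
  by rewrite -{1}(linvK a); apply: hsym_reduced hr.
have one p' q' r' : reduced p'.1 -> hsym p' = rank (linv a) -> hsym q' != rank (linv a) ->
    hsym r' != rank (linv a) -> cyc 0 (pushp a p') (pushp a q') (pushp a r') = cyc 0 p' q' r'.
  move=> hp Ep Nq Nr; have [x Ex [-> Nx]] := caseH _ hp Ep.
  have E1 : hsym (pushp a q') = hsym (pushp a r') by rewrite !hsym_pushp.
  have E2 : hsym (pushp a q') != hsym (x, p'.2) by rewrite hsym_pushp // eq_sym.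
  rewrite (cyc_outside E1 E2) !pushp_cons // lt_cons.
  by rewrite cyc_first Ep // -!surjective_pairing.
have two p' q' r' : reduced q'.1 -> reduced r'.1 -> hsym p' != rank (linv a) ->
    hsym q' = rank (linv a) -> hsym r' = rank (linv a) ->
    cyc 0 (pushp a p') (pushp a q') (pushp a r') = cyc 0 p' q' r'.
  move=> hq hr Np Eq Er.
  have [x Ex [-> Nx]] := caseH _ hq Eq; have [y Ey [-> Ny]] := caseH _ hr Er.
  have E1 : hsym q' = hsym r' by rewrite Eq Er.
  have E2 : hsym q' != hsym p' by rewrite Eq eq_sym.
  rewrite (cyc_outside E1 E2) cyc_first ?hsym_pushp //.
  by rewrite [in RHS]Ex [in RHS]Ey lt_cons linvK.
move=> hp hq hr.
case: (hsym p =P rank (linv a)) => [Ep|/eqP Np];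
case: (hsym q =P rank (linv a)) => [Eq|/eqP Nq];
case: (hsym r =P rank (linv a)) => [Er|/eqP Nr].
- have [x Ex [-> Nx]] := caseH _ hp Ep; have [y Ey [-> Ny]] := caseH _ hq Eq.
  have [z Ez [-> Nz]] := caseH _ hr Er; rewrite Ex Ey Ez [RHS]/cyc !lt_cons linvK.
  by rewrite -(@cyc_cut (rank a)).
- by rewrite [RHS]cyc_rot [LHS]cyc_rot [RHS]cyc_rot [LHS]cyc_rot two.
- by rewrite [RHS]cyc_rot [LHS]cyc_rot two.
- by rewrite one.
- by rewrite two.
- by rewrite [RHS]cyc_rot [LHS]cyc_rot one.
- by rewrite [RHS]cyc_rot [LHS]cyc_rot [RHS]cyc_rot [LHS]cyc_rot one.
by rewrite !pushp_cons // {1}/cyc !lt_cons -(@cyc_cut (rank (linv a)) p) //.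
Qed.

Definition mulp u p : point := (reduce (u ++ p.1), p.2).

Lemma cyc_mulp u p q r : reduced p.1 -> reduced q.1 -> reduced r.1 ->
  cyc 0 (mulp u p) (mulp u q) (mulp u r) = cyc 0 p q r.
Proof.
move=> hp hq hr; elim: u => [|a u IH].
  by rewrite /mulp /= !reduce_id // -!surjective_pairing.
by rewrite -IH -[RHS](@cyc_pushp a) //; exact: reduced_reduce.
Qed.

End Order.

(** * Braid generators preserve the order *)

Section Monotone.
Variable n : nat.
Implicit Types (x y z u v w : word n) (a b : letter n) (p q r : point n).
Implicit Types (f g : 'I_n -> word n).

Definition extp f p : point n := (ext f p.1, p.2).

Definition monotone f := forall p q, reduced p.1 -> reduced q.1 ->
  lt 0 p q -> lt 0 (extp f p) (extp f q).

Section Criterion.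
Variables (f : 'I_n -> word n) (T : word n -> letter n).

(* [T] names the image under [ext f] of the cone of words with a given first letter;
   these images form intervals lying in the same order as the cones. *)
Definition psym p := if p.1 is [::] then hsym p else rank (T p.1).

Hypothesis T_image : forall a y, reduced y -> (y != [::] -> T y != linv a) ->
  reduce (subw f [:: a] ++ y) != [::] /\ T (reduce (subw f [:: a] ++ y)) = a.
Hypothesis psym_lt : forall p q, reduced p.1 -> reduced q.1 ->
  psym p < psym q -> lt 0 p q.

Lemma ext_cons a x : ext f (a :: x) = reduce (subw f [:: a] ++ ext f x).
Proof. by rewrite /ext reduce_catr -[in LHS]/(subw _ _) subw_cons. Qed.

Lemma psym_ext p : reduced p.1 -> psym (extp f p) = hsym p.
Proof.
case: p => x e /=; elim: x => // a x IH h; rewrite /psym /= ext_cons.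
have hx := reduced_behead h; have {}IH := IH hx.
have [||] := @T_image a (ext f x); first exact: reduced_ext.
  move=> ne; apply: contra (hsym_reduced e h); rewrite -IH /psym /=.
  by case: (ext f x) ne => // b y _ /eqP ->.
by case: (reduce _) => // b y _ ->.
Qed.

Lemma psym_hsym_neq0 a p : psym p = rank a -> hsym p != 0.
Proof.
case: p => [[|b x] e]; rewrite /psym /=; first by move->; rewrite -lt0n rank_gt0.
by move=> _; rewrite /hsym /= -lt0n rank_gt0.
Qed.

(** Points with different first symbols have images of different types. A common first letter [a] is
    removed by a translation, which preserves the cyclic order; the images of the tails are then
    compared by induction or by type. *)
Lemma monotone_by_type : monotone f.
Proof.
case=> [x e] [y e'] /=; elim: x y => [|a x IH] y hx hy hlt.
  case: (@hsym n ([::], e) =P hsym (y, e')) => [E|/eqP N].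
    case: y E hlt {hy} => [|b y] E; first by rewrite /lt /= E ltnn.
    by move: E; rewrite /hsym /z_rank /=; case: e; have := rank_gt0 b; have := rank_lt b; lia.
  apply: (@psym_lt (extp f _) (extp f _) (reduced_ext _ _) (reduced_ext _ _)).
  by rewrite !psym_ext // ltn_neqAle N (lt_hsym hlt).
case: (hsym (a :: x, e) =P hsym (y, e')) => [E|/eqP N]; last first.
  apply: (@psym_lt (extp f _) (extp f _) (reduced_ext _ _) (reduced_ext _ _)).
  by rewrite !psym_ext // ltn_neqAle N (lt_hsym hlt).
have /= Ey := hsym_rank (esym E); move: hy hlt; rewrite Ey {E Ey}.
move: (behead y) => {}y hy; rewrite lt_cons => hlt.
(* [A] is chosen so that multiplication by the image of [a] sends it to the base point, seen from
   which the cyclic order is [lt 0]. *)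
set A := (ext f [:: linv a], true); set P := extp f (x, e); set Q := extp f (y, e').
have hx1 := reduced_behead hx; have hy1 := reduced_behead hy.
have sA : psym A = rank (linv a) by rewrite (@psym_ext ([:: linv a], true)).
have sP : psym P = hsym (x, e) by rewrite psym_ext.
have sQ : psym Q = hsym (y, e') by rewrite psym_ext.
have nP := hsym_reduced e hx; have nQ := hsym_reduced e' hy.
have rA : reduced A.1 by exact: reduced_ext.
have rP : reduced P.1 by exact: reduced_ext.
have rQ : reduced Q.1 by exact: reduced_ext.
have bP := hsym_lt (x, e); have bQ := hsym_lt (y, e').
have bA : rank (linv a) < (2 * n).+2 by apply: leqW; apply: rank_lt.
have hc : cyc 0 A P Q.
  have lAP := psym_lt rA rP; have lPA := psym_lt rP rA.
  have lAQ := psym_lt rA rQ; have lQA := psym_lt rQ rA.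
  have lPQ := psym_lt rP rQ; rewrite sA sP sQ in lAP lPA lAQ lQA lPQ.
  case: (hsym (x, e) =P hsym (y, e')) => [E|/eqP N].
    have l0 : lt 0 P Q by apply: IH => //; rewrite (lt_eq 0 (rank (linv a))).
    rewrite /cyc l0 /=; case: (ltngtP (hsym (x, e)) (rank (linv a))) => h.
    - by rewrite (lQA _) ?orbT // -E.
    - by rewrite lAP.
    - by rewrite h eqxx in nP.
  move: hlt; rewrite lt_neq // key_lt // /cyc.
  have eP : (rank (linv a) <= hsym (x, e)) = (rank (linv a) < hsym (x, e)).
    by rewrite leq_eqVlt eq_sym (negbTE nP).
  have eQ : (rank (linv a) <= hsym (y, e')) = (rank (linv a) < hsym (y, e')).
    by rewrite leq_eqVlt eq_sym (negbTE nQ).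
  rewrite eP eQ; case: (ltngtP (rank (linv a)) (hsym (x, e))) => h1;
  case: (ltngtP (rank (linv a)) (hsym (y, e'))) => h2 //= h3.
  - by rewrite lAP ?lPQ.
  - by rewrite lQA ?lAP ?orbT.
  - by rewrite -h2 eqxx in nQ.
  - by rewrite lPQ ?lQA ?orbT.
  - by rewrite -h2 eqxx in nQ.
  - by rewrite -h1 eqxx in nP.
  - by rewrite -h1 eqxx in nP.
have key : mulp (subw f [:: a]) A = ([::], true).
  by rewrite /mulp /A /= extE subw1V reduce_catr -[_ ++ winv _]cats0 -catA reduce_winvr.
rewrite -(cyc_mulp (subw f [:: a])) // key in hc.
have eP : mulp (subw f [:: a]) P = extp f (a :: x, e) by rewrite /extp /= ext_cons.
have eQ : mulp (subw f [:: a]) Q = extp f (a :: y, e') by rewrite /extp /= ext_cons.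
by rewrite eP eQ cyc_base // in hc; apply: (@psym_hsym_neq0 a); rewrite psym_ext.
Qed.

End Criterion.

(** For [j = i + 1] this is a standard braid generator, and [sigV] is its inverse. *)
Definition sig (i j k : 'I_n) : word n :=
  if k == i then [:: (j, true)]
  else if k == j then [:: (j, false); (i, true); (j, true)] else gen k.

Definition sigV (i j k : 'I_n) : word n :=
  if k == j then [:: (i, true)]
  else if k == i then [:: (i, true); (j, true); (i, false)] else gen k.

Section Sigma.
Variables (i j : 'I_n).
Hypothesis ij : j = i.+1 :> nat.

Lemma ord_neq_succ : (i == j) = false /\ (j == i) = false.
Proof. by split; apply/eqP => h; move: ij; rewrite h; lia. Qed.

(* The image of the cone of [t_j] is the cone of [t_j^-1 t_i], that of [t_j^-1] is the
   cone of [t_j^-1 t_i^-1], that of [t_i^-1] the rest of the cone of [t_j^-1], and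
   that of [t_i] the union of the cones of [t_i], [t_i^-1] and [t_j]. *)
Definition sig_type x : letter n :=
  match x with
  | a :: x' =>
    if a == (j, false) then
      match x' with
      | b :: _ => if b == (i, true) then (j, true)
                  else if b == (i, false) then (j, false) else (i, false)
      | [::] => (i, false)
      end
    else if (a.1 == i) || (a.1 == j) then (i, true) else a
  | [::] => (i, true)
  end.

Lemma sig_type_ij c x : c != (j, false) -> (c.1 == i) || (c.1 == j) ->
  sig_type (c :: x) = (i, true).
Proof. by move=> /negbTE h1 h2; rewrite /= h1 h2. Qed.

Lemma sig_type_other c x : c.1 != i -> c.1 != j -> sig_type (c :: x) = c.
Proof.
move=> /negbTE h1 /negbTE h2; rewrite /= h1 h2 /=.
by case: (c =P (j, false)) h2 => [->|]; rewrite ?eqxx.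
Qed.

Lemma sig_type_image a y : reduced y -> (y != [::] -> sig_type y != linv a) ->
  reduce (subw (sig i j) [:: a] ++ y) != [::] /\
  sig_type (reduce (subw (sig i j) [:: a] ++ y)) = a.
Proof.
have [nij nji] := ord_neq_succ.
have letE (k l : 'I_n) (b c : bool) : ((k, b) == (l, c) :> letter n) = (k == l) && (b == c) by [].
move=> hy; rewrite reduce_cat (reduce_id hy).
case: a => k e; rewrite /subw /= cats0 /sig /linv /=.
case: (k =P i) => [->|/eqP nki].
  case: e; rewrite /winv /linv /=.
    case: y hy => [|c y] hy; first by rewrite sig_type_ij // ?letE ?nji ?eqxx ?orbT ?andbF.
    move/(_ isT); rewrite [push _ _]/= /linv /=.
    case: (c =P (j, false)) => [_|/eqP nc] hT; last first.
      by rewrite sig_type_ij // ?letE ?eqxx ?orbT ?andbF.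
    case: y hT {hy} => [|[l b] y]; first by rewrite eqxx.
    rewrite !letE; case: (l =P i) => [->|_]; last by rewrite /= eqxx.
    by rewrite sig_type_ij ?letE ?nij ?eqxx.
  case: y hy => [|[l b] y] hy; first by move=> _; rewrite /= /linv /= eqxx.
  move/(_ isT) => hT.
  have hl : l != i.
    by apply: contra hT => /eqP ->; rewrite sig_type_ij ?letE ?nij ?eqxx.
  have hlb : (l, b) != (j, true).
    by apply: contra hT => /eqP ->; rewrite sig_type_ij ?letE ?eqxx ?orbT ?andbF.
  rewrite /= /linv /= (negbTE hlb) /=; split=> //.
  by rewrite eqxx !letE (negbTE hl).
case: (k =P j) => [->|/eqP nkj].
  have -> : (if e then [:: (j, false); (i, true); (j, true)]
    else winv [:: (j, false); (i, true); (j, true)]) = [:: (j, false); (i, e); (j, true)].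
    by case: e.
  rewrite /= => hT; set v := push (j, true) y.
  have hv x : v <> (i, ~~ e) :: x.
    rewrite /v; case: y hy hT {v} => [|c y] hy; first by move=> _ [] /eqP; rewrite nji.
    move/(_ isT); rewrite [push _ _]/= /linv /=; case: (c =P (j, false)) => [_|_] hT.
      move=> E; move: hT; rewrite E /= !letE eqxx /=.
      by case: (e); rewrite /= !eqxx.
    by case=> /eqP; rewrite nji.
  have -> : push (i, e) v = (i, e) :: v.
    case: (v) hv => [|c x] // hv; rewrite /= /linv /=; case: eqP => // E.
    by case: (hv x); rewrite E.
  rewrite /= /linv /= letE nij /=; split=> //.
  by rewrite eqxx !letE eqxx; case: (e).
rewrite /gen => hT.
have -> : (if e then [:: (k, true)] else winv [:: (k, true)]) = [:: (k, e)] by case: (e).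
have -> : foldr (@push n) y [:: (k, e)] = (k, e) :: y.
  case: y hy hT => [|c y] hy //= /(_ isT); rewrite /linv /=.
  case: (c =P (k, ~~ e)) => // ->; rewrite letE (negbTE nkj) (negbTE nki) /=.
  by rewrite eqxx.
by rewrite sig_type_other.
Qed.

Lemma sig_type_lt p q : reduced p.1 -> reduced q.1 ->
  psym sig_type p < psym sig_type q -> lt 0 p q.
Proof.
move=> _ _.
have rij : [/\ rank (i, true) = (2 * i).+1, rank (i, false) = (2 * i).+2,
   rank (j, true) = (2 * i).+3 & rank (j, false) = (2 * i).+4].
  by rewrite /rank /= ij; split; lia.
have [ri riV rj rjV] := rij.
have Efs x e : psym sig_type ((j, false) :: x, e) =
    if hsym (x, e) == (2 * i).+1 then (2 * i).+3
    else if hsym (x, e) == (2 * i).+2 then (2 * i).+4 else (2 * i).+2.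
  rewrite /psym /= eqxx; case: x => [|b x] /=.
    rewrite riV /hsym /z_rank /=; have := ltn_ord j; case: e => hj.
      by [].
    by case: eqP; [lia|]; case: eqP; lia.
  rewrite /hsym /= -ri -riV !(inj_eq (@rank_inj n)).
  by case: ifP => _ //; case: ifP => _ //.
(* Types weakly follow first symbols: three consecutive cones merge into the type [t_i], and only
   the cone of [t_j^-1], of rank [2i + 4], is split. *)
have facts p' : (hsym p' != (2 * i).+4 /\ ((psym sig_type p' = hsym p' /\
     ~~ ((2 * i).+1 <= hsym p' <= (2 * i).+3)) \/
     (psym sig_type p' = (2 * i).+1 /\ (2 * i).+1 <= hsym p' <= (2 * i).+3)))
   \/ (hsym p' = (2 * i).+4 /\ (2 * i).+2 <= psym sig_type p' <= (2 * i).+4).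
  case: p' => [[|a x] e].
    left; rewrite /psym /hsym /z_rank /=; have := ltn_ord j; case: e; lia.
  case: (a =P (j, false)) => [->|na].
    right; rewrite Efs; split; first by rewrite /hsym /= rjV.
    by case: ifP => _; [lia|case: ifP => _; lia].
  left; rewrite /psym /hsym /= (introF eqP na); split.
    by rewrite -rjV (inj_eq (@rank_inj n)); apply/eqP.
  case: ifP => h; [right|left].
    split; first by rewrite ri.
    case: a h na => k [] /= /orP[/eqP ->|/eqP ->] na; rewrite ?ri ?riV ?rj ?rjV; try lia.
    by case: na.
  split=> //; case: a h na => k b /= /norP[h1 h2] na.
  have hk1 : k <> i :> nat by move/val_inj/eqP; apply/negP.
  have hk2 : k <> j :> nat by move/val_inj/eqP; apply/negP.
  by rewrite /rank /=; case: b {na}; lia.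
move=> hlt.
have fp := facts p; have fq := facts q.
case: (ltngtP (hsym p) (hsym q)) => h; [exact: lt_of_hsym | lia |].
case: (hsym p =P (2 * i).+4) => [E|nE]; last by lia.
have Ep := hsym_rank (etrans E (esym rjV)).
have Eq := hsym_rank (etrans (etrans (esym h) E) (esym rjV)).
case: p q Ep Eq hlt {fp fq h E} => [x e] [y e'] /= -> ->.
move: (behead x) (behead y) => {}x {}y; rewrite !Efs lt_cons => hlt.
(* Below [t_j^-1] the order starts at [t_j], so the symbols [t_i] and [t_i^-1], of ranks [2i + 1]
   and [2i + 2], come last. This matches the order of the three types into which the cone is
   split. *)
have -> : rank (linv (j, false)) = (2 * i).+3 by [].
have bx := hsym_lt (x, e); have by' := hsym_lt (y, e'); have bj := ltn_ord j.
have ne : hsym (x, e) != hsym (y, e') by apply/eqP => E; rewrite E ltnn in hlt.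
rewrite lt_neq // key_lt //; last by lia.
move: (hsym (x, e)) (hsym (y, e')) hlt bx by' ne => s t.
case: (leqP (2 * i).+3 s) => h1; case: (leqP (2 * i).+3 t) => h2 /=;
case: eqP => ?; case: eqP => ?; try case: eqP => ?; try case: eqP => ?; lia.
Qed.

Lemma monotone_sig : monotone (sig i j).
Proof. exact: monotone_by_type sig_type_image sig_type_lt. Qed.

End Sigma.
End Monotone.

(** * The group of braid automorphisms *)

Section BraidGroup.
Variable n : nat.
Implicit Types (x y z u v w : word n) (a b : letter n) (p q r : point n).
Implicit Types (f g : 'I_n -> word n).

Definition invw f g := forall x, reduced x -> ext g (ext f x) = x.

Lemma invw_gen f g : (forall k, ext g (f k) = gen k) -> invw f g.
Proof.
move=> h x hx; rewrite -ext_compw (@ext_eqf _ _ (@gen n)) => [|k].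
  by rewrite extE subw_genid reduce_id.
by rewrite /eqv /compw h.
Qed.

Lemma monotone_comp f g : monotone f -> monotone g -> monotone (compw f g).
Proof.
move=> hf hg p q hp hq h; rewrite /extp !ext_compw.
apply: (hg (extp f p) (extp f q)); try exact: reduced_ext.
exact: hf.
Qed.

(** The order is total, so if [g] did not preserve a comparison, it would reverse it or identify the
    points, and [f] would undo that in contradiction with the given order. *)
Lemma monotone_inv f g : invw g f -> monotone f -> monotone g.
Proof.
move=> gf hf p q hp hq h.
have back p' : reduced p'.1 -> extp f (extp g p') = p'.
  by case: p' => x e /= hx; rewrite /extp /= gf.
case: (extp g p =P extp g q) => [E|/eqP ne].
  by move: h; rewrite -(back p hp) -(back q hq) E lt_irr.
have /orP[//|h'] := lt_total (ltn0Sn _) ne.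
have := hf (extp g q) (extp g p) (reduced_ext g q.1) (reduced_ext g p.1) h'.
by rewrite !back // (lt_asym _ h).
Qed.

Lemma is_aut_inv f g : invw f g -> invw g f -> is_aut f.
Proof.
move=> fg gf; split=> [u v hu hv E | v hv].
  by rewrite -(fg u hu) -(fg v hv) E.
by exists (ext g v); split; [exact: reduced_ext | exact: gf].
Qed.

Definition tprod : word n := map (fun k => (k, true)) (enum 'I_n).

Lemma reduced_pos (s : seq 'I_n) : reduced (map (fun k => (k, true)) s).
Proof.
case: s => // k s; rewrite /reduced /=; elim: s k => //= l s IH k.
by rewrite IH andbT /linv /=; apply/eqP => -[].
Qed.

Lemma ext_z1 f : ext f tprod = tprod -> ext f (z1 n) = z1 n.
Proof.
move=> h; rewrite /z1 -/tprod ext_winv h reduce_id // reduced_winv.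
exact: reduced_pos.
Qed.

Lemma ext_tprod f : ext f (z1 n) = z1 n -> ext f tprod = tprod.
Proof.
move=> h; rewrite -(winvK tprod) ext_winv [winv tprod]/(z1 n) h.
by rewrite reduce_id // reduced_winv /z1 reduced_winv reduced_pos.
Qed.

Lemma conjugateP u v : reduced v ->
  (exists h : word n, eqv (winv h ++ u ++ h) v) -> Defs.conjugate u v.
Proof.
move=> hv [g E]; exists (reduce g); split; first exact: reduced_reduce.
rewrite -[RHS](reduce_id hv) -E; apply: eqv_cat.
  exact: eqv_winv (eqv_reduce g).
by apply: eqv_cat => //; exact: eqv_reduce.
Qed.

Lemma conj_reduce u v : reduce (winv v ++ reduce u ++ v) = reduce (winv v ++ u ++ v).
Proof. by rewrite -reduce_catr reduce_catl reduce_catr. Qed.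

Lemma in_Bn_comp f g : in_Bn f -> in_Bn g -> in_Bn (compw f g).
Proof.
case=> [[fi fs] fz [s hs]] [[gi gs] gz [t ht]]; split.
- split=> [u v hu hv|v hv]; rewrite ?ext_compw.
    by move/(gi _ _ (reduced_ext _ _) (reduced_ext _ _))/(fi _ _ hu hv).
  have [u [hu Eu]] := gs v hv; have [x [hx Ex]] := fs u hu.
  by exists x; rewrite ext_compw Ex.
- by rewrite ext_compw fz.
exists (s * t)%g => k; rewrite ext_compw permM.
have [x [hx Ex]] := hs k; have [y [hy Ey]] := ht (s k).
apply: conjugateP => //; exists (ext g x ++ y).
rewrite -Ey; apply: etrans (esym (eqv_reduce _)).
rewrite winv_cat -catA; apply: eqv_cat => //; rewrite !catA; apply: eqv_cat => //.
rewrite -!catA -Ex ext_reduce; apply: etrans (esym (eqv_reduce _)).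
rewrite -[flatten _]/(subw g _) !subw_cat subw_winv; apply: eqv_cat.
  exact: eqv_winv (eqv_reduce _).
by apply: eqv_cat; exact: eqv_reduce.
Qed.

Lemma in_Bn_gen : in_Bn (@gen n).
Proof.
have gid x : ext (@gen n) x = reduce x by rewrite extE subw_genid.
split.
- split=> [u v hu hv|v hv]; rewrite ?gid; first by rewrite !reduce_id.
  by exists v; rewrite gid reduce_id.
- by apply: ext_z1; rewrite gid reduce_id // reduced_pos.
by exists 1%g => k; apply: conjugateP => //; exists [::]; rewrite perm1 gid.
Qed.

Section Sigma.
Variables (i j : 'I_n).
Hypothesis ij : j = i.+1 :> nat.

Lemma enum_split : exists s1 s2, [/\ enum 'I_n = s1 ++ i :: j :: s2,
  forall k, k \in s1 -> (k != i) && (k != j) & forall k, k \in s2 -> (k != i) && (k != j)].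
Proof.
have hi : i < size (enum 'I_n) by rewrite size_enum_ord.
have hj : j < size (enum 'I_n) by rewrite size_enum_ord.
have E : enum 'I_n = take i (enum 'I_n) ++ i :: j :: drop i.+2 (enum 'I_n).
  rewrite -{1}(cat_take_drop i (enum 'I_n)) (drop_nth i hi) nth_ord_enum -ij.
  by rewrite (drop_nth i hj) nth_ord_enum.
have := enum_uniq 'I_n; rewrite E.
move: (take _ _) (drop _ _) {E} (E) => s1 s2 E.
rewrite cat_uniq /= !inE !negb_or => /and3P[_ h1 /and3P[/andP[_ h2] h3 _]].
exists s1, s2; split=> // k hk; apply/andP; split; apply/eqP => ek; subst k.
- by move: h1; rewrite /= hk ?andbF ?orbT.
- by move: h1; rewrite /= hk ?andbF ?orbT.
- by rewrite hk in h2.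
- by rewrite hk in h3.
Qed.

Lemma subw_fixed f (s : seq 'I_n) : (forall k, k \in s -> f k = gen k) ->
  subw f (map (fun k => (k, true)) s) = map (fun k => (k, true)) s.
Proof.
elim: s => // k s IH h; rewrite /= subw_cons IH => [|l hl].
  by rewrite /subw /= h ?mem_head.
by apply: h; rewrite in_cons hl orbT.
Qed.

Lemma ext_tprod_local f : (forall k, k != i -> k != j -> f k = gen k) ->
  eqv (f i ++ f j) [:: (i, true); (j, true)] -> ext f tprod = tprod.
Proof.
move=> hf E; rewrite -[RHS](reduce_id (reduced_pos (enum 'I_n))) extE /tprod.
have [s1 [s2 [-> h1 h2]]] := enum_split.
rewrite map_cat /= subw_cat (subw_cons f (i, true)) (subw_cons f (j, true)).
rewrite subw_fixed => [|k /h1 /andP[]]; last exact: hf.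
rewrite subw_fixed => [|k /h2 /andP[]]; last exact: hf.
apply: eqv_cat => //; rewrite catA.
by apply: (@eqv_cat _ _ [:: (i, true); (j, true)]) => //; rewrite /subw /= !cats0.
Qed.

Lemma ext_sig_tprod : ext (sig i j) tprod = tprod.
Proof.
have [nij nji] := ord_neq_succ ij.
apply: ext_tprod_local => [k /negbTE h1 /negbTE h2|]; first by rewrite /sig h1 h2.
by rewrite /sig eqxx nji eqxx; apply: (@reduce_winvr _ [:: (j, true)]).
Qed.

Lemma ext_sigV_tprod : ext (sigV i j) tprod = tprod.
Proof.
have [nij nji] := ord_neq_succ ij.
apply: ext_tprod_local => [k /negbTE h1 /negbTE h2|]; first by rewrite /sigV h1 h2.
rewrite /sigV eqxx nij eqxx /=.
exact: (@eqv_cat _ [:: _; _] _ _ _ erefl (@reduce_winvl _ [:: (i, true)] [::])).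
Qed.

Lemma sigK : invw (sig i j) (sigV i j).
Proof.
have [nij nji] := ord_neq_succ ij.
apply: invw_gen => k; rewrite /sig; case: (k =P i) => [->|/eqP/negbTE ki].
  by rewrite extE /subw /= /sigV eqxx.
case: (k =P j) => [->|/eqP/negbTE kj].
  rewrite extE /subw /= /sigV !eqxx nij /= /winv /= /linv /=.
  by rewrite !(xpair_eqE, eqxx, nij, nji, andbF).
by rewrite extE /subw /= /sigV ki kj.
Qed.

Lemma sigVK : invw (sigV i j) (sig i j).
Proof.
have [nij nji] := ord_neq_succ ij.
apply: invw_gen => k; rewrite /sigV; case: (k =P j) => [->|/eqP/negbTE kj].
  by rewrite extE /subw /= /sig eqxx.
case: (k =P i) => [->|/eqP/negbTE ki].
  rewrite extE /subw /= /sig !eqxx nji /= /winv /= /linv /=.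
  by rewrite !(xpair_eqE, eqxx, nij, nji, andbF) /= eqxx.
by rewrite extE /subw /= /sig ki kj.
Qed.

Lemma monotone_sigV : monotone (sigV i j).
Proof. exact: monotone_inv sigVK (monotone_sig ij). Qed.

Lemma in_Bn_sig : in_Bn (sig i j).
Proof.
have [nij nji] := ord_neq_succ ij.
split; first exact: is_aut_inv sigK sigVK.
  by apply: ext_z1; exact: ext_sig_tprod.
exists (tperm i j) => k; apply: conjugateP => //; rewrite extE subw_gen /sig.
case: tpermP => [->|->|/eqP/negbTE -> /eqP/negbTE ->].
- by exists [::]; rewrite eqxx.
- exists [:: (j, false)]; rewrite nji eqxx /eqv conj_reduce.
  by apply: (eqv_cat (@reduce_winvl _ [:: (j, false)] [:: (i, true)])
    (@reduce_winvr _ [:: (j, true)] [::])).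
by exists [::].
Qed.

Lemma in_Bn_sigV : in_Bn (sigV i j).
Proof.
have [nij nji] := ord_neq_succ ij.
split; first exact: is_aut_inv sigVK sigK.
  by apply: ext_z1; exact: ext_sigV_tprod.
exists (tperm i j) => k; apply: conjugateP => //; rewrite extE subw_gen /sigV.
case: tpermP => [->|->|/eqP/negbTE -> /eqP/negbTE ->].
- exists [:: (i, true)]; rewrite nij eqxx /eqv conj_reduce.
  by apply: (eqv_cat (@reduce_winvl _ [:: (i, true)] [:: (j, true)])
    (@reduce_winvl _ [:: (i, true)] [::])).
- by exists [::]; rewrite eqxx.
by exists [::].
Qed.

End Sigma.
End BraidGroup.

(** * Artin's lemma *)

Arguments reduced : simpl never.
Arguments winv : simpl never.

Section Artin.
Variable n : nat.
Implicit Types (x y z u v w : word n) (a b : letter n) (k : 'I_n).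
Implicit Types (f g : 'I_n -> word n).

Definition conjw u k : word n := winv u ++ (k, true) :: u.

(** Leading powers of [t_k] commute with [t_k]; removing them keeps the conjugate and makes its
    written form reduced. *)
Fixpoint strip k v : word n :=
  if v is a :: v' then if a.1 == k then strip k v' else v else [::].

Lemma conjw_strip k v : eqv (conjw (strip k v) k) (conjw v k).
Proof.
elim: v => //= -[l b] v IH /=; case: (l =P k) => [->|//].
apply: etrans IH _; rewrite /conjw winv_cons -catA; apply: eqv_cat => //.
symmetry; case: b; first exact: (@reduce_winvl _ [:: (k, true)] ((k, true) :: v)).
exact: (@eqv_cat _ [:: (k, true)] _ _ _ erefl (@reduce_winvr _ [:: (k, true)] v)).
Qed.

Lemma eqv_conjw u v k : eqv u v -> eqv (conjw u k) (conjw v k).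
Proof.
move=> h; apply: eqv_cat; first exact: eqv_winv.
by rewrite -(cat1s _ u) -(cat1s _ v); apply: eqv_cat.
Qed.

Lemma reduced_cat_cons x a y : reduced (x ++ a :: y) = reduced (rcons x a) && reduced (a :: y).
Proof.
case: x => [|b x] //=; rewrite /reduced /= cat_path rcons_path /=.
by rewrite andbA.
Qed.

Lemma reduced_catl x y : reduced (x ++ y) -> reduced x.
Proof. by case: x => // a x; rewrite /reduced /= cat_path => /andP[]. Qed.

Lemma reduced_catr x y : reduced (x ++ y) -> reduced y.
Proof. by elim: x => // a x IH /reduced_behead. Qed.

Lemma reduced_rcons2 x a b : reduced (rcons (rcons x a) b) = (b != linv a) && reduced (rcons x a).
Proof.
rewrite -(cats1 (rcons x a)) -!cats1 -catA /= reduced_cat_cons cats1 andbC.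
by rewrite reduced_cons2 andbT.
Qed.

Lemma reduced_conjw u k : reduced u -> (forall (b : bool) v, u <> (k, b) :: v) -> reduced (conjw u k).
Proof.
move=> hu nk; rewrite /conjw reduced_cat_cons; case: u hu nk => [|[l b] v] // hu nk.
have nl : (l == k) = false.
  by apply/eqP => E; case: (nk b v); rewrite E.
rewrite winv_cons cats1 reduced_rcons2 -cats1 -winv_cons reduced_winv hu.
by rewrite reduced_cons2 hu /linv /= !xpair_eqE nl eq_sym nl.
Qed.

Lemma strip_suffix k v : exists h, v = h ++ strip k v /\ all (fun a => a.1 == k) h.
Proof.
elim: v => [|a v [h [E ha]]] /=; first by exists [::].
case: ifP => hk; last by exists [::].
by exists (a :: h); rewrite /= hk -E.
Qed.

Lemma strip_head k v (b : bool) v' : strip k v <> (k, b) :: v'.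
Proof.
elim: v => //= a v IH; case: ifP => // hk E; move: hk; case: E => -> _.
by rewrite /= eqxx.
Qed.

Lemma reduced_conjw_strip k v : reduced v -> reduced (conjw (strip k v) k).
Proof.
move=> hv; apply: reduced_conjw => [|b v']; last exact: strip_head.
by have [h [E _]] := strip_suffix k v; rewrite E in hv; exact: reduced_catr hv.
Qed.

Lemma size_push a v : size (push a v) <= (size v).+1.
Proof. by case: v => //= b v; case: ifP => //= _; lia. Qed.

Lemma size_reduce v : size (reduce v) <= size v.
Proof.
by elim: v => // a v IH; rewrite reduce_cons /=; apply: leq_trans (size_push _ _) _.
Qed.

Lemma conjw_normal k v : exists u, [/\ reduced (conjw u k), eqv (conjw u k) (conjw v k) &
  size u <= size v].
Proof.
exists (strip k (reduce v)); split.
- exact/reduced_conjw_strip/reduced_reduce.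
- by rewrite /eqv conjw_strip; apply: eqv_conjw; exact: eqv_reduce.
have [h [E _]] := strip_suffix k (reduce v).
by apply: leq_trans (size_reduce v); rewrite {2}E size_cat leq_addl.
Qed.

(** The word [c] is the longest common suffix, which is exactly what cancels in [u v^-1 = y z]. *)
Lemma cancel_split u v : reduced u -> reduced v -> exists y c z,
  [/\ u = y ++ c, v = winv z ++ c & reduced (y ++ z)].
Proof.
elim/last_ind: u v => [|u a IH] v hu hv.
  by exists [::], [::], (winv v); rewrite winvK !cats0 reduced_winv.
case/lastP: v hv => [|v b] hv; first by exists (rcons u a), [::], [::]; rewrite !cats0.
case: (a =P b) => [<-|ne].
  rewrite -!cats1 in hu hv *.
  have [y [c [z [-> -> h]]]] := IH v (reduced_catl hu) (reduced_catl hv).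
  by exists y, (c ++ [:: a]), z; rewrite !catA.
exists (rcons u a), [::], (winv (rcons v b)); rewrite winvK !cats0; split=> //.
have E : winv (rcons v b) = linv b :: winv v by rewrite -cats1 winv_cat.
rewrite {1}E reduced_cat_cons reduced_rcons2 hu andbT -E reduced_winv hv andbT.
by rewrite (inj_eq (can_inj (@linvK n))) eq_sym (introN eqP ne).
Qed.

(* No Hurwitz move on the two neighbouring factors shortens one of them. *)
Definition irr_pair (s t : 'I_n * word n) : bool :=
  ~~ suffix ((s.1, true) :: s.2) t.2 && ~~ suffix ((t.1, false) :: t.2) s.2.

Definition tword (L : seq ('I_n * word n)) : word n :=
  flatten (map (fun s => conjw s.2 s.1) L).

(** Between neighbouring factors only conjugators cancel: to destroy a central letter, one
    conjugator would have to end with the other preceded by that letter or its inverse, which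
    [irr_pair] excludes. Hence each factor contributes its central letter, and the length equals the
    number of factors only if nothing else is left. *)
Lemma tword_normal s L : all (fun s => reduced (conjw s.2 s.1)) (s :: L) ->
  path irr_pair s L -> exists rest,
  [/\ reduce (tword (s :: L)) = winv s.2 ++ (s.1, true) :: rest,
      size L <= size rest &
      size rest = size L -> [/\ s.2 = [::], all (fun t => t.2 == [::]) L &
        rest = map (fun t => (t.1, true)) L]].
Proof.
elim: L s => [|t L IH] s /=.
  rewrite andbT => hs _; exists s.2; rewrite /tword /= cats0 reduce_id //; split=> //.
  by move/eqP; rewrite size_eq0 => /eqP ->.
case/and3P=> hs ht hL /andP[hst hp].
have [|rest [E hsz heq]] := IH t _ hp; first by rewrite /= ht hL.
have hu : reduced s.2 by apply: reduced_behead (reduced_catr hs).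
have hv : reduced t.2 by apply: reduced_behead (reduced_catr ht).
have [y [c [z [Eu Ev hyz]]]] := cancel_split hu hv.
exists (y ++ z ++ (t.1, true) :: rest).
have E' : reduce (tword (s :: t :: L)) = winv s.2 ++ (s.1, true) :: y ++ z ++ (t.1, true) :: rest.
  have -> : reduce (tword (s :: t :: L)) =
      reduce (winv s.2 ++ (s.1, true) :: y ++ z ++ (t.1, true) :: rest).
    rewrite -[tword _]/(conjw s.2 s.1 ++ tword (t :: L)) {1}/conjw -catA; apply: eqv_cat => //.
    apply: (@eqv_cat _ [:: (s.1, true)] [:: (s.1, true)]) => //.
    rewrite -/(eqv _ _); apply: (@etrans _ _ (reduce (s.2 ++ reduce (tword (t :: L))))).
      by rewrite reduce_catr.
    rewrite E Ev Eu winv_cat winvK -!catA; apply: eqv_cat => //.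
    exact: reduce_winvr.
  apply: reduce_id.
  have hr : reduced (z ++ (t.1, true) :: rest).
    apply: (@reduced_catr (winv c)).
    rewrite catA -{1}(winvK z) -winv_cat -Ev -E; exact: reduced_reduce.
  have hs1 : reduced (winv s.2 ++ (s.1, true) :: y).
    by apply: (@reduced_catl _ c); rewrite -catA /= -Eu.
  case/andP: hst => n1 n2.
  rewrite reduced_cat_cons; move: hs1; rewrite reduced_cat_cons => /andP[-> hy] /=.
  (* The four cases are the junctions that can occur around [y ++ z]: two positive central letters,
     a central letter against [z] or against [y], and [y] against [z]. *)
  case/lastP: y Eu hyz hy => [|y a] Eu hyz hy.
    case: z Ev hyz hr => [|b z] Ev hyz hr; first by rewrite /= reduced_cons2 hr andbT /linv /= xpair_eqE andbF.
    rewrite /= reduced_cons2 hr andbT; apply: contra n1 => /eqP Eb.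
    by rewrite Ev Eb winv_cons linvK -catA /= -[c]/([::] ++ c) -Eu suffix_suffix.
  case: z Ev hyz hr => [|b z] Ev hyz hr.
    rewrite cat_rcons -cat_cons reduced_cat_cons rcons_cons hy /=.
    rewrite reduced_cons2 hr andbT; apply: contra n2 => /eqP Eb.
    have Ea : a = (t.1, false) by rewrite -(linvK a) -Eb.
    by rewrite Eu Ea cat_rcons (Ev : t.2 = c) suffix_suffix.
  rewrite cat_rcons -cat_cons reduced_cat_cons rcons_cons hy /=.
  rewrite reduced_cons2 hr andbT; move: hyz; rewrite cat_rcons reduced_cat_cons => /andP[_].
  by rewrite reduced_cons2 => /andP[].
split=> //; first by rewrite !size_cat /=; lia.
rewrite !size_cat /= => hsz'.
have [y0 [z0 r0]] : size y = 0 /\ size z = 0 /\ size rest = size L.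
  by move: hsz hsz'; move: (size y) (size z) (size rest) (size L) => * {E E'}; lia.
have [t0 a0 Er] := heq r0.
move: y0 z0 => /eqP; rewrite size_eq0 => /eqP y0 /eqP; rewrite size_eq0 => /eqP z0.
subst y z; rewrite /= in Eu Ev *; rewrite t0 /= a0 Er Eu -Ev t0; split=> //.
Qed.

Lemma tword_trivial L : all (fun s => reduced (conjw s.2 s.1)) L ->
  sorted irr_pair L -> size (reduce (tword L)) = size L ->
  all (fun s => s.2 == [::]) L /\ reduce (tword L) = map (fun s => (s.1, true)) L.
Proof.
case: L => // s L hall hp; have [rest [-> hsz h]] := tword_normal hall hp.
rewrite size_cat /= => hs.
have r0 : size rest = size L.
  by move: hsz hs; move: (size (winv _)) (size rest) (size L) => *; lia.
by have [-> -> ->] := h r0.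
Qed.

Lemma sum_update (i j : 'I_n) (F G : 'I_n -> nat) : i != j ->
  (forall k, k != i -> k != j -> F k = G k) -> F i + F j < G i + G j ->
  \sum_k F k < \sum_k G k.
Proof.
move=> nij hk h; have nji : j != i by rewrite eq_sym.
have S H : \sum_k H k = H i + (H j + \sum_(k | (k != i) && (k != j)) H k).
  by rewrite (bigD1 i) // (bigD1 j).
rewrite !S (eq_bigr G) => [|k /andP[h1 h2]]; last exact: hk.
by move: (\sum_(k | _) _) => T; lia.
Qed.

Lemma monotone_eqv f g : (forall x, reduced x -> ext f x = ext g x) ->
  monotone f -> monotone g.
Proof. by move=> E h p q hp hq /(h p q hp hq); rewrite /extp !E. Qed.

(** The conjugating element [v^-1 a^-1 v] removes the letter [a] from [z a v]; this is the
    shortening in a Hurwitz move. *)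
Lemma conjw_hurwitz a z v k :
  eqv ((winv v ++ a :: v) ++ conjw (z ++ a :: v) k ++ (winv v ++ linv a :: v))
      (conjw (z ++ v) k).
Proof.
have -> : winv v ++ linv a :: v = winv (a :: v) ++ v by rewrite winv_cons -catA.
rewrite /conjw winv_cat -!catA (winv_cat z v) -catA; apply: eqv_cat => //.
rewrite /eqv reduce_winvr; apply: eqv_cat => //.
rewrite -!cat_cons -!catA; apply: eqv_cat => //.
exact: reduce_winvr.
Qed.

Lemma artin_step f (s : 'I_n -> 'I_n) (u : 'I_n -> word n) (i j : 'I_n) :
  j = i.+1 :> nat -> (forall k, reduced (conjw (u k) (s k))) ->
  (forall k, eqv (f k) (conjw (u k) (s k))) ->
  ~~ irr_pair (s i, u i) (s j, u j) ->
  exists f' s' (u' : 'I_n -> word n), [/\ (forall k, reduced (conjw (u' k) (s' k))),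
     (forall k, eqv (f' k) (conjw (u' k) (s' k))), ext f' (tprod n) = ext f (tprod n),
     \sum_k size (u' k) < \sum_k size (u k) & monotone f' -> monotone f].
Proof.
move=> ij hr hf; have [nij nji] := ord_neq_succ ij.
pose upd T (F : 'I_n -> T) (A B : T) k := if k == i then A else if k == j then B else F k.
have main f' k1 v1 k2 v2 : eqv (f' i) (conjw v1 k1) -> eqv (f' j) (conjw v2 k2) ->
    (forall k, k != i -> k != j -> eqv (f' k) (f k)) ->
    size v1 + size v2 < size (u i) + size (u j) ->
    exists s' (u' : 'I_n -> word n), [/\ (forall k, reduced (conjw (u' k) (s' k))),
      (forall k, eqv (f' k) (conjw (u' k) (s' k))) &
      \sum_k size (u' k) < \sum_k size (u k)].
  move=> E1 E2 E3 hs.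
  have [w1 [r1 e1 s1]] := conjw_normal k1 v1; have [w2 [r2 e2 s2]] := conjw_normal k2 v2.
  exists (upd _ s k1 k2), (upd _ u w1 w2); rewrite /upd; split=> [k|k|].
  - by case: (k == i) => //; case: (k == j).
  - case: (k =P i) => [->|/eqP ki]; first by rewrite /eqv E1.
    case: (k =P j) => [->|/eqP kj]; first by rewrite /eqv E2.
    by rewrite /eqv E3 ?hf.
  apply: (@sum_update i j) => [|k /negbTE -> /negbTE ->|] //; first by rewrite nij.
  by rewrite !eqxx nji; lia.
rewrite /irr_pair /= negb_and !negbK => /orP[] /suffixP [z Ez].
(* The new pair of factors is [f_i f_j f_i^-1, f_i]: the conjugator of [f_j] contains [t_(s i) u_i]
   and loses the letter [t_(s i)]. *)
- pose f' := compw (sigV i j) f.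
  have [||k ki kj|| s' [u' [h1 h2 h3]]] := main f' (s j) (z ++ u i) (s i) (u i).
  + rewrite /eqv /f' /compw /sigV nij eqxx reduce_id ?reduced_ext // extE /subw /= cats0.
    rewrite -(@conjw_hurwitz (s i, true)) -Ez; apply: eqv_cat; first exact: hf.
    apply: eqv_cat; first exact: hf.
    by rewrite /eqv (eqv_winv (hf i)) /conjw winv_cat winvK winv_cons -catA.
  + by rewrite /eqv /f' /compw /sigV eqxx reduce_id ?reduced_ext // extE /subw /= cats0 hf.
  + by rewrite /eqv /f' /compw /sigV (negbTE ki) (negbTE kj) reduce_id ?reduced_ext // extE subw_gen.
  + by rewrite Ez !size_cat /=; lia.
  exists f', s', u'; split=> //; first by rewrite ext_compw ext_sigV_tprod.
  move=> hm; apply: monotone_eqv (monotone_comp (monotone_sig ij) hm) => x hx.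
  by rewrite !ext_compw sigK.
(* The new pair of factors is [f_j, f_j^-1 f_i f_j], and the conjugator of [f_i] loses a letter
   [t_(s j)^-1]. *)
- pose f' := compw (sig i j) f.
  have [||k ki kj|| s' [u' [h1 h2 h3]]] := main f' (s j) (u j) (s i) (z ++ u j).
  + by rewrite /eqv /f' /compw /sig eqxx reduce_id ?reduced_ext // extE /subw /= cats0 hf.
  + rewrite /eqv /f' /compw /sig nji eqxx reduce_id ?reduced_ext // extE /subw /= cats0.
    rewrite -(@conjw_hurwitz (s j, false)) -Ez; apply: eqv_cat; last by apply: eqv_cat; exact: hf.
    by rewrite /eqv (eqv_winv (hf j)) /conjw winv_cat winvK winv_cons -catA.
  + by rewrite /eqv /f' /compw /sig (negbTE ki) (negbTE kj) reduce_id ?reduced_ext // extE subw_gen.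
  + by rewrite Ez !size_cat /=; lia.
  exists f', s', u'; split=> //; first by rewrite ext_compw ext_sig_tprod.
  move=> hm; apply: monotone_eqv (monotone_comp (monotone_sigV ij) hm) => x hx.
  by rewrite !ext_compw sigVK.
Qed.

(** Induction on the total length of the conjugators. If no move applies, the product [t_1 ... t_n]
    has as many letters as factors, which makes every conjugator trivial and [f] the identity. *)
Theorem artin_monotone f (s : 'I_n -> 'I_n) (u : 'I_n -> word n) :
  (forall k, reduced (conjw (u k) (s k))) ->
  (forall k, eqv (f k) (conjw (u k) (s k))) ->
  ext f (tprod n) = tprod n -> monotone f.
Proof.
move: {2}(\sum_k size (u k)).+1 (ltnSn (\sum_k size (u k))) => N.
elim: N f s u => // N IH f s u hN hr hf hp.
pose L := [seq (s k, u k) | k <- enum 'I_n].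
have szL : size L = n by rewrite size_map size_enum_ord.
have [hs|] := boolP (sorted irr_pair L).
  have hall : all (fun t => reduced (conjw t.2 t.1)) L.
    by apply/allP => t /mapP[k _ ->]; apply: hr.
  have EL : reduce (tword L) = tprod n.
    rewrite -hp extE /tprod /L /tword.
    elim: (enum 'I_n) => // k ks IHk; rewrite /= (subw_cons f); apply: eqv_cat => //.
    by rewrite -/(eqv _ _) /subw /= cats0 /eqv hf.
  have [|h1 h2] := tword_trivial hall hs; first by rewrite EL szL size_map size_enum_ord.
  have u0 k : u k = [::].
    by apply/eqP; move/allP: h1 => /(_ (s k, u k)); apply; apply: map_f; rewrite mem_enum.
  have sk k : s k = k.
    have := h2; rewrite EL /L /tprod -map_comp => /eq_in_map /(_ k).
    by rewrite mem_enum => /(_ isT) [].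
  have E x : reduced x -> ext (@gen n) x = ext f x.
    move=> hx; apply: ext_eqf => k; rewrite /eqv hf u0 sk; reflexivity.
  apply: monotone_eqv E _ => -[x e] [y e'] /= hx hy.
  by rewrite /extp /= !extE !subw_genid !reduce_id.
move=> hns.
have [i [j [ij hij]]] : exists i j : 'I_n, j = i.+1 :> nat /\ ~~ irr_pair (s i, u i) (s j, u j).
  have [/existsP[i /existsP[j /andP[/eqP ij h]]]|] :=
    boolP [exists i : 'I_n, exists j : 'I_n, (j == i.+1 :> nat) && ~~ irr_pair (s i, u i) (s j, u j)].
    by exists i, j.
  move=> hno; case/negP: hns; case: (posnP n) => [n0|n0].
    by rewrite (size0nil (etrans szL n0)).
  pose o := Ordinal n0; apply/(sortedP (s o, u o)) => m; rewrite szL => hm.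
  have hm' : m < n by exact: ltnW.
  have E (k : 'I_n) : nth (s o, u o) L k = (s k, u k).
    by rewrite /L (nth_map o (s o, u o) (fun k => (s k, u k))) ?nth_ord_enum ?size_enum_ord.
  rewrite (E (Ordinal hm')) (E (Ordinal hm)).
  move: hno => /existsPn /(_ (Ordinal hm')) /existsPn /(_ (Ordinal hm)).
  by rewrite eqxx negbK.
have [f' [s' [u' [h1 h2 h3 h4 h5]]]] := artin_step ij hr hf hij.
apply: h5; apply: (IH f' s' u') => //; first by lia.
by rewrite h3.
Qed.

End Artin.

(** * Simple words *)

Section Simple.
Variable n : nat.
Implicit Types (x y z u v w g h : word n) (a b : letter n) (p q r s : point n).

(* For distinct points: [r] and [s] lie on the same side of the arc from [p] to [q]. *)
Definition unlinked p q r s : bool := cyc 0 p r q == cyc 0 p s q.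

Definition simple w := forall g, reduced g -> g != [::] ->
  unlinked ([::], true) (w, false) (g, true) (reduce (g ++ w), false).

Lemma monotone_lt f p q : monotone f -> reduced p.1 -> reduced q.1 ->
  lt 0 (extp f p) (extp f q) = lt 0 p q.
Proof.
move=> hf hp hq; case: (p =P q) => [->|/eqP ne]; first by rewrite !lt_irr.
have /orP[h|h] := lt_total (ltn0Sn (2 * n).+1) ne.
  by rewrite h (hf _ _ hp hq h).
by rewrite (lt_asym _ h) // (lt_asym _ (hf _ _ hq hp h)).
Qed.

(** By surjectivity every translate of the image arc is the image of a translate. *)
Lemma simple_ext f w : monotone f ->
  (forall v, reduced v -> exists u, reduced u /\ ext f u = v) ->
  reduced w -> simple w -> simple (ext f w).
Proof.
move=> hf hs hw hsw g hg ng; have [g0 [hg0 Eg]] := hs g hg.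
have ng0 : g0 != [::] by apply: contraNneq ng => E; rewrite -Eg E.
have E p q r : reduced p.1 -> reduced q.1 -> reduced r.1 ->
    cyc 0 (extp f p) (extp f q) (extp f r) = cyc 0 p q r.
  by move=> hp hq hr; rewrite /cyc !monotone_lt.
have := hsw g0 hg0 ng0; rewrite /unlinked.
rewrite -(E _ (g0, true)) // -(E _ (reduce (g0 ++ w), false)) //; last exact: reduced_reduce.
by rewrite /extp /= Eg ext_reduce ext_cat Eg.
Qed.

Lemma unlinked_mulp u p q r s : reduced p.1 -> reduced q.1 -> reduced r.1 -> reduced s.1 ->
  unlinked (mulp u p) (mulp u q) (mulp u r) (mulp u s) = unlinked p q r s.
Proof. by move=> *; rewrite /unlinked !cyc_mulp. Qed.

Lemma cyc_anti p q r : p != q -> q != r -> p != r -> cyc 0 p r q = ~~ cyc 0 p q r.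
Proof.
have h0 := ltn0Sn (2 * n).+1.
move=> npq nqr npr; rewrite /cyc.
have := lt_total h0 npq; have := lt_total h0 nqr; have := lt_total h0 npr.
have a1 := @lt_asym _ 0 p q h0; have a2 := @lt_asym _ 0 q r h0; have a3 := @lt_asym _ 0 p r h0.
have t1 := @lt_trans _ 0 q p r h0; have t2 := @lt_trans _ 0 q r p h0.
move: a1 a2 a3 t1 t2.
case: (lt 0 p q); case: (lt 0 q p); case: (lt 0 q r); case: (lt 0 r q);
case: (lt 0 p r); case: (lt 0 r p) => //= a1 a2 a3 t1 t2;
by (try have := a1 isT; try have := a2 isT; try have := a3 isT; try have := t1 isT isT;
    try have := t2 isT isT).
Qed.

Lemma unlinkedC p q r s : p != q -> p != r -> p != s -> q != r -> q != s ->
  unlinked q p r s = unlinked p q r s.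
Proof.
move=> *; rewrite /unlinked.
have E t : p != t -> q != t -> cyc 0 q t p = ~~ cyc 0 p t q.
  by move=> h1 h2; rewrite (cyc_rot 0 q) (cyc_rot 0 t) -cyc_anti // eq_sym.
by rewrite !E // (inj_eq negb_inj).
Qed.

Lemma unlinkedCr p q r s : unlinked p q s r = unlinked p q r s.
Proof. by rewrite /unlinked eq_sym. Qed.

(* Translating by the inverse of the prefix of length [k] puts the ends of the arc of
   [w] at [pt w k.*2] and [pt w k.*2.+1]; entry [i] of the Whitehead expansion is the
   first symbol of [pt w i].  [low] and [up] exchange the two ends of the lower and
   upper arcs. *)
Definition pt w (i : nat) : point n :=
  if odd i then (drop i./2 w, false) else (winv (take i./2 w), true).

Definition low (i : nat) := if odd i then i.+1 else i.-1.
Definition up (i : nat) := if odd i then i.-1 else i.+1.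

Lemma reduced_pt w i : reduced w -> reduced (pt w i).1.
Proof.
move=> hw; rewrite /pt; case: ifP => _ /=; last rewrite reduced_winv.
  by apply: (@reduced_catr _ (take i./2 w)); rewrite cat_take_drop.
by apply: (@reduced_catl _ _ (drop i./2 w)); rewrite cat_take_drop.
Qed.

Lemma pt_inj w i j : i < (size w).*2.+2 -> j < (size w).*2.+2 -> pt w i = pt w j -> i = j.
Proof.
move=> hi hj; rewrite /pt; have := odd_double_half i; have := odd_double_half j.
case: (odd i); case: (odd j) => // Ej Ei [] /(congr1 size).
  by rewrite !size_drop => h; lia.
by rewrite !size_winv !size_take_min => h; lia.
Qed.

Lemma pt_odd w k : pt w k.*2.+1 = (drop k w, false).
Proof. by rewrite /pt /= odd_double /= uphalf_double. Qed.

Lemma pt_even w k : pt w k.*2 = (winv (take k w), true).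
Proof. by rewrite /pt odd_double doubleK. Qed.

Lemma low_odd k : low k.*2.+1 = k.+1.*2.
Proof. by rewrite /low /= odd_double. Qed.

Lemma low_even k : low k.+1.*2 = k.*2.+1.
Proof. by rewrite /low odd_double. Qed.

Lemma up_odd k : up k.*2.+1 = k.*2.
Proof. by rewrite /up /= odd_double. Qed.

Lemma up_even k : up k.*2 = k.*2.+1.
Proof. by rewrite /up odd_double. Qed.

Lemma posP i : (exists k, i = k.*2) \/ (exists k, i = k.*2.+1).
Proof. by have := odd_double_half i; case: odd => /= E; [right|left]; exists i./2; lia. Qed.

(** An arc that leaves the tile through the side [a] is seen from the next tile after multiplication
    by [a^-1]: the arc with ends [up i] and [i] becomes the one with ends [low i] and
    [up (low i)]. *)
Lemma pt_tail w i : 0 < i < (size w).*2.+1 -> exists a,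
  pt w i = (a :: (pt w (up (low i))).1, (pt w (up (low i))).2) /\
  pt w (low i) = (linv a :: (pt w (up i)).1, (pt w (up i)).2).
Proof.
move=> /andP[i0 iN].
have dr k : k < size w -> exists a, drop k w = a :: drop k.+1 w /\
    winv (take k.+1 w) = linv a :: winv (take k w).
  move=> hk; case: w hk {i0 iN} => // a0 w' hk; exists (nth a0 (a0 :: w') k).
  by rewrite (drop_nth a0) // (take_nth a0) // -cats1 winv_cat.
case: (posP i) => -[k E]; subst i; last first.
  have [|a [E1 E2]] := dr k; first by lia.
  by exists a; rewrite low_odd up_even up_odd !pt_odd !pt_even E1 E2.
case: k i0 iN => // k _ iN.
have [|a [E1 E2]] := dr k; first by lia.
by exists (linv a); rewrite low_even up_odd up_even !pt_odd !pt_even E1 E2 linvK.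
Qed.

Lemma low_lt w i : 0 < i < (size w).*2.+1 -> 0 < low i < (size w).*2.+1.
Proof. by case: (posP i) => -[[|k] ->]; rewrite ?low_odd ?low_even; lia. Qed.

Lemma up_lt w i : i < (size w).*2.+2 -> up i < (size w).*2.+2.
Proof. by case: (posP i) => -[[|k] ->]; rewrite ?up_odd ?up_even; lia. Qed.

Lemma lowK i : 0 < i -> low (low i) = i.
Proof. by case: (posP i) => -[[|k] ->] // _; rewrite ?low_odd ?low_even ?low_odd. Qed.

Lemma upK i : up (up i) = i.
Proof. by case: (posP i) => -[k ->]; rewrite ?up_odd ?up_even ?up_odd. Qed.

Lemma up_half i : (up i)./2 = i./2.
Proof. by case: (posP i) => -[k ->]; rewrite ?up_odd ?up_even ?up_odd; lia. Qed.

Lemma half_up i j : i./2 = j./2 -> i != j -> i = up j.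
Proof.
by case: (posP i) => -[k ->]; case: (posP j) => -[l ->]; rewrite ?up_odd ?up_even; lia.
Qed.

Definition arcs_unlinked w := forall k l, k <= size w -> l <= size w -> k != l ->
  unlinked (pt w k.*2) (pt w k.*2.+1) (pt w l.*2) (pt w l.*2.+1).

Lemma arc_mulp w k : reduced w ->
  pt w k.*2 = mulp (winv (take k w)) ([::], true) /\
  pt w k.*2.+1 = mulp (winv (take k w)) (w, false).
Proof.
move=> hw; have h1 := reduced_pt k.*2 hw; have h2 := reduced_pt k.*2.+1 hw.
rewrite pt_even pt_odd in h1 h2 *; rewrite /mulp /= cats0 reduce_id //.
by have := reduce_winvl (take k w) (drop k w); rewrite cat_take_drop (reduce_id h2) => ->.
Qed.

Lemma arc_mulp2 w k l : reduced w ->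
  pt w l.*2 = mulp (winv (take k w)) (reduce (take k w ++ winv (take l w)), true) /\
  pt w l.*2.+1 = mulp (winv (take k w))
    (reduce (reduce (take k w ++ winv (take l w)) ++ w), false).
Proof.
move=> hw; have [-> ->] := arc_mulp l hw.
have E x y z : reduce (winv x ++ reduce (x ++ y) ++ z) = reduce (y ++ z).
  by rewrite -(reduce_catr (winv x)) reduce_catl reduce_catr -catA reduce_winvl.
by rewrite /mulp /= cats0 !reduce_catr reduce_winvl E.
Qed.

(** The arcs numbered [k] and [l] differ by the translation [take k w (take l w)^-1], nontrivial
    because distinct prefixes of a reduced word are distinct elements. *)
Lemma arcs_of_simple w : reduced w -> simple w -> arcs_unlinked w.
Proof.
move=> hw hs k l hk hl nkl.
have [-> ->] := arc_mulp k hw; have [-> ->] := arc_mulp2 k l hw.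
rewrite unlinked_mulp //; try exact: reduced_reduce.
apply: hs; first exact: reduced_reduce.
apply: contra nkl => /eqP E.
have : reduce (take k w) = reduce (take l w).
  rewrite -(cats0 (take k w)) -[[::]](reduce_winvl (take l w) [::]) reduce_catr cats0.
  by rewrite catA -reduce_catl E.
have rt m : reduced (take m w) by apply: (@reduced_catl _ _ (drop m w)); rewrite cat_take_drop.
by rewrite !reduce_id // => /(congr1 size); rewrite !size_take_min; lia.
Qed.

Lemma common_prefix g w : exists h x y, [/\ g = h ++ x, w = h ++ y &
  if (x, y) is (a :: _, b :: _) then a != b else true].
Proof.
elim: g w => [|a g IH] w; first by exists [::], [::], w.
case: w => [|b w]; first by exists [::], (a :: g), [::].
case: (a =P b) => [->|/eqP ne].
  have [h [x [y [-> -> hxy]]]] := IH w; by exists (b :: h), x, y.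
by exists [::], (a :: g), (b :: w).
Qed.

(** Let [h] be the common prefix of [g] and [w], seen as paths from the tile of [1]. Either the
    translate by [g] passes through the tile of [h], so that the pair is covered by [arcs_unlinked],
    or it stays in one cone seen from there. *)
Lemma simple_of_arcs w : reduced w -> arcs_unlinked w -> simple w.
Proof.
move=> hw ha g hg ng; have [h [x [y [Eg Ew hxy]]]] := common_prefix g w.
have th : take (size h) w = h by rewrite Ew take_size_cat.
have dh : drop (size h) w = y by rewrite Ew drop_size_cat.
have hx : reduced x by rewrite Eg in hg; exact: reduced_catr hg.
have hwV : reduced (winv w) by rewrite reduced_winv.
have [y0 [c [z [Ex Ez hyz]]]] := cancel_split hx hwV.
have {}Ez : w = winv c ++ z by rewrite -(winvK w) Ez winv_cat winvK.
case: y0 Ex hyz => [|b y0] Ex hyz.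
  rewrite /= in Ex; subst c.
  have tx : take (size x) w = winv x by rewrite Ez -(size_winv x) take_size_cat.
  have Egg : g = reduce (take (size h) w ++ winv (take (size x) w)).
    by rewrite th tx winvK -Eg reduce_id.
  have [e1 e2] := arc_mulp (size h) hw; have [e3 e4] := arc_mulp2 (size h) (size x) hw.
  have := ha (size h) (size x); rewrite e1 e2 e3 e4 unlinked_mulp //; try exact: reduced_reduce.
  rewrite -Egg; apply.
  - by rewrite Ew size_cat leq_addr.
  - by rewrite Ez size_cat size_winv leq_addr.
  apply: contra ng => /eqP E; apply/eqP; rewrite Egg E.
  by rewrite -(cats0 (_ ++ _)) -catA reduce_winvr.
have e3 : mulp (winv h) (g, true) = (x, true).
  by rewrite /mulp /= Eg reduce_winvl reduce_id.
have e4 : mulp (winv h) (reduce (g ++ w), false) = (b :: y0 ++ z, false).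
  rewrite /mulp /= reduce_catr Eg -catA reduce_winvl Ex {1}Ez -catA.
  have -> : b :: y0 ++ z = reduce ((b :: y0) ++ z) by rewrite reduce_id.
  by congr pair; apply: eqv_cat => //; exact: reduce_winvr.
rewrite -(unlinked_mulp (winv h)) //; last exact: reduced_reduce.
have [e1 e2] := arc_mulp (size h) hw.
rewrite th in e1 e2; rewrite -e1 -e2 e3 e4 pt_even pt_odd th dh /unlinked.
(* Seen from the tile of [h], the translated arc has both ends in the cone of [b] and the arc of [w]
   has none there, so they cannot be linked. *)
have nA : hsym (winv h, true) != rank b.
  case/lastP: h Eg {Ew th dh e1 e2 e3 e4} => [|h a] Eg.
    by rewrite /hsym /= eq_sym -lt0n rank_gt0.
  move: hg; rewrite Eg Ex cat_rcons /= => /reduced_catr; rewrite reduced_cons2 => /andP[nb _].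
  rewrite -cats1 winv_cat /hsym /=; apply: contra nb => /eqP /rank_inj <-; by rewrite eqxx.
have nB : hsym (y, false) != rank b.
  rewrite Ex /= in hxy; case: y hxy {Ew dh e1 e2} => [_|a y nab].
    by rewrite /hsym /z_rank /=; have := rank_lt b; lia.
  by rewrite /hsym /= (inj_eq (@rank_inj n)) eq_sym.
have hG : hsym (x, true) = rank b by rewrite Ex.
have hG' : hsym (b :: y0 ++ z, false) = rank b by [].
by rewrite /cyc !(@lt_neq _ _ (winv h, _)) ?hG ?hG' // !(@lt_neq _ _ _ (y, _)) ?hG ?hG' // eq_sym.
Qed.

End Simple.

(** * Planarity is simplicity *)

Lemma nestedC a b c d : nested b a c d = nested a b c d.
Proof.
rewrite /nested minnC maxnC; congr (_ && _); apply: perm_uniq.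
by rewrite -[[:: b; a; c; d]]/([:: b; a] ++ _) -[[:: a; b; c; d]]/([:: a; b] ++ _) perm_cat2r (perm_catC [:: b] [:: a]).
Qed.

Lemma nestedCr a b c d : nested a b d c = nested a b c d.
Proof.
rewrite /nested [in RHS]eq_sym; congr (_ && _); apply: perm_uniq.
by rewrite -[[:: a; b; c; d]]/([:: a; b] ++ _) -[[:: a; b; d; c]]/([:: a; b] ++ _) perm_cat2l (perm_catC [:: d] [:: c]).
Qed.

Lemma nestedP a b c d : nested a b c d =
  [&& a != b, a != c, a != d, b != c, b != d, c != d &
   ((minn a b < c) && (c < maxn a b)) == ((minn a b < d) && (d < maxn a b))].
Proof. by rewrite /nested /= !inE !negb_or andbT -!andbA. Qed.

Definition ncyc a b c := [|| (a < b) && (b < c), (b < c) && (c < a) | (c < a) && (a < b)].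

(** Linking of two pairs depends only on the cyclic order of the four numbers. *)
Lemma nested_ncyc a b c d : a != b -> a != c -> a != d -> b != c -> b != d -> c != d ->
  nested a b c d = (ncyc a c b == ncyc a d b).
Proof.
move=> h1 h2 h3 h4 h5 h6; rewrite nestedP h1 h2 h3 h4 h5 h6 /= /ncyc /minn /maxn.
case: (ltngtP a b) h1 => // hab _; case: (ltngtP a c) h2 => // hac _;
case: (ltngtP a d) h3 => // had _; case: (ltngtP b c) h4 => // hbc _;
case: (ltngtP b d) h5 => // hbd _ //=; lia.
Qed.

Section Planar.
Variable n : nat.
Implicit Types (x y z u v w g h : word n) (a b : letter n) (p q r s : point n).

Lemma size_whitehead w : size (whitehead w) = (size w).*2.+2.
Proof.
rewrite /whitehead /= size_cat /= addn1; congr _.+2.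
by elim: w => //= a w ->; rewrite doubleS.
Qed.

Lemma nth_whitehead w i : i < (size w).*2.+2 -> nth 0 (whitehead w) i = hsym (pt w i).
Proof.
have pairs k : k <= size w -> nth 0 (flatten (map (fun x : letter n => [:: rank x; rank (linv x)]) w) ++ [:: z_rank n]) k.*2
     = hsym (drop k w, false).
  by elim: w k => [|a w IH] [|k] //= hk; rewrite IH.
have pairs' k : k < size w -> nth 0 (flatten (map (fun x : letter n => [:: rank x; rank (linv x)]) w) ++ [:: z_rank n]) k.*2.+1
     = hsym (winv (take k.+1 w), true).
  move=> hk; case: w {pairs} hk => // a0 w' hk.
  rewrite (take_nth a0) // -cats1 winv_cat /hsym /=.
  by elim: w' a0 k hk => [|a w IH] a0 [|k] //= hk; rewrite ?(IH a) // (set_nth_default a).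
case: (posP i) => -[k ->] hk.
  case: k hk => [|k] hk; first by rewrite pt_even take0.
  by rewrite pt_even -pairs' //; lia.
by rewrite pt_odd -pairs //; lia.
Qed.

Lemma hsym_up w i : reduced w -> 0 < i < (size w).*2.+1 ->
  hsym (pt w (up i)) != hsym (pt w i).
Proof.
move=> hw hi; have [a [E1 E2]] := pt_tail hi.
have h := reduced_pt (low i) hw; rewrite E2 in h.
have := hsym_reduced (pt w (up i)).2 h; rewrite linvK -surjective_pairing.
by rewrite E1.
Qed.

Lemma pt_neq w i j : i < (size w).*2.+2 -> j < (size w).*2.+2 -> i != j ->
  pt w i != pt w j.
Proof. by move=> hi hj; apply: contra => /eqP /pt_inj ->. Qed.

Lemma arcs_up w i j : arcs_unlinked w -> i < (size w).*2.+2 -> j < (size w).*2.+2 ->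
  i./2 != j./2 -> unlinked (pt w (up i)) (pt w i) (pt w (up j)) (pt w j).
Proof.
move=> ha hi hj nij.
have h k l : k <= size w -> l <= size w -> k != l -> [&&
    unlinked (pt w k.*2) (pt w k.*2.+1) (pt w l.*2) (pt w l.*2.+1) &
    unlinked (pt w k.*2.+1) (pt w k.*2) (pt w l.*2) (pt w l.*2.+1)].
  by move=> hk hl nkl; rewrite (@unlinkedC _ (pt w k.*2)) ?ha //; apply: pt_neq; lia.
case: (posP i) => -[k E]; case: (posP j) => -[l E']; subst i j; rewrite ?up_odd ?up_even.
all: have [|||h1 h2] := andP (h k l _ _ _); [lia|lia|lia|].
all: by rewrite ?h1 ?h2 // unlinkedCr ?h1 ?h2.
Qed.

(** Cut the circle at the common symbol [a]: both arcs start there, and being unlinked they have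
    their other ends in the opposite order. Up to the letter [linv a] put in front, these other ends
    are the points [low i] and [low j]. *)
Lemma low_reverse w i j : reduced w -> arcs_unlinked w ->
  0 < i < (size w).*2.+1 -> 0 < j < (size w).*2.+1 -> hsym (pt w i) = hsym (pt w j) ->
  lt 0 (pt w i) (pt w j) -> lt 0 (pt w (low j)) (pt w (low i)).
Proof.
move=> hw ha hi hj Eh hlt.
have [a [Ei Ei']] := pt_tail hi; have [b [Ej Ej']] := pt_tail hj.
have sa : hsym (pt w i) = rank a by rewrite Ei.
have sb : hsym (pt w j) = rank b by rewrite Ej.
have eab : a = b by apply: rank_inj; rewrite -sa -sb.
subst b; rewrite Ei' Ej' lt_cons linvK -!surjective_pairing.
have ui : hsym (pt w (up i)) != rank a by rewrite -sa hsym_up.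
have uj : hsym (pt w (up j)) != rank a by rewrite -sb hsym_up.
have ra : rank a < (2 * n).+2 by apply: leqW; exact: rank_lt.
have nij : i != j by apply: contraTneq hlt => ->; rewrite lt_irr.
have nup : i != up j by apply: contraNneq uj => <-; rewrite sa.
have nhalf : i./2 != j./2 by apply: contra nup => /eqP /half_up -> //.
have hi2 : i < (size w).*2.+2 by lia.
have hj2 : j < (size w).*2.+2 by lia.
have ne : pt w (up j) != pt w (up i).
  by apply: pt_neq; rewrite ?up_lt //; apply: contra nij => /eqP E; rewrite -(upK i) -E upK.
have := arcs_up ha hi2 hj2 nhalf; rewrite /unlinked -!(cyc_cut _ _ _ ra).
have first k l : hsym (pt w k) = rank a -> hsym (pt w l) != rank a -> lt (rank a) (pt w k) (pt w l).
  move=> E N; rewrite lt_neq ?E 1?eq_sym // key_lt ?hsym_lt // leqnn.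
  have := N; case: (ltngtP (rank a) (hsym (pt w l))) => //=.
have h1 := first _ _ sa ui; have h2 := first _ _ sa uj.
have h3 := first _ _ sb ui; have h4 := first _ _ sb uj.
have h5 : lt (rank a) (pt w i) (pt w j) by rewrite (lt_eq _ 0).
rewrite /cyc h1 (lt_asym ra h2) (lt_asym ra h3) (lt_asym ra h5) ?andbF ?andbT ?orbF /=.
rewrite eqbF_neg => h6; have /orP[//|h7] := lt_total ra ne.
by rewrite h7 in h6.
Qed.

(** Position of [pt w i] after sorting: the permutation that witnesses planarity. *)
Definition rk w i := count (fun j => lt 0 (pt w j) (pt w i)) (iota 0 (size w).*2.+2).

Lemma rk_mono w i j : i < (size w).*2.+2 -> lt 0 (pt w i) (pt w j) -> rk w i < rk w j.
Proof.
move=> hi hlt; rewrite /rk; set I := iota _ _.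
have -> : (count (fun k => lt 0 (pt w k) (pt w i)) I).+1 =
   count (predU (fun k => lt 0 (pt w k) (pt w i)) (pred1 i)) I.
  have := count_predUI (fun k => lt 0 (pt w k) (pt w i)) (pred1 i) I.
  have -> : count (predI (fun k => lt 0 (pt w k) (pt w i)) (pred1 i)) I = 0.
    apply/eqP; rewrite -leqn0 leqNgt -has_count; apply/hasPn => k _ /=.
    by apply/negP => /andP[h /eqP E]; rewrite E lt_irr in h.
  rewrite addn0 => ->; rewrite (count_uniq_mem _ (iota_uniq _ _)) mem_iota /= add0n hi.
  by rewrite addn1.
apply: sub_count => k /orP[h|/eqP ->] //.
exact: lt_trans h hlt.
Qed.

Lemma rk_lt w i j : i < (size w).*2.+2 -> j < (size w).*2.+2 ->
  (rk w i < rk w j) = lt 0 (pt w i) (pt w j).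
Proof.
move=> hi hj; case: (i =P j) => [->|/eqP ne]; first by rewrite ltnn lt_irr.
have h0 := ltn0Sn (2 * n).+1.
have /orP[h|h] := lt_total h0 (pt_neq hi hj ne); first by rewrite h rk_mono.
by rewrite (lt_asym h0 h) ltnNge ltnW // rk_mono.
Qed.

Lemma rk_inj w i j : i < (size w).*2.+2 -> j < (size w).*2.+2 -> rk w i = rk w j -> i = j.
Proof.
move=> hi hj E; apply/eqP/negPn/negP => ne.
have /orP[] := lt_total (ltn0Sn (2 * n).+1) (pt_neq hi hj ne).
  by rewrite -rk_lt // E ltnn.
by rewrite -rk_lt // E ltnn.
Qed.

Lemma rk_bound w i : i < (size w).*2.+2 -> rk w i < (size w).*2.+2.
Proof.
move=> hi; rewrite /rk -{2}(size_iota 0 (size w).*2.+2) ltn_neqAle count_size andbT -all_count.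
apply/allPn; exists i; first by rewrite mem_iota.
by rewrite lt_irr.
Qed.


Lemma lt_cut c p q : c < (2 * n).+2 ->
  lt c p q = if (c <= hsym p) == (c <= hsym q) then lt 0 p q else c <= hsym p.
Proof.
move=> hc; case: (hsym p =P hsym q) => [E|/eqP N]; first by rewrite (lt_eq c 0) // E eqxx.
by rewrite !lt_neq // !key_lt ?hsym_lt // !leq0n eqxx.
Qed.

Lemma ncyc_order (w : word n) (q : nat -> nat) :
  (forall i j, i < (size w).*2.+2 -> j < (size w).*2.+2 ->
     (q i < q j) = lt 0 (pt w i) (pt w j)) ->
  forall i j k, i < (size w).*2.+2 -> j < (size w).*2.+2 -> k < (size w).*2.+2 ->
  ncyc (q i) (q j) (q k) = cyc 0 (pt w i) (pt w j) (pt w k).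
Proof. by move=> h i j k hi hj hk; rewrite /ncyc /cyc !h. Qed.

Lemma nested_order (w : word n) (q : nat -> nat) :
  (forall i j, i < (size w).*2.+2 -> j < (size w).*2.+2 ->
     (q i < q j) = lt 0 (pt w i) (pt w j)) ->
  (forall i j, i < (size w).*2.+2 -> j < (size w).*2.+2 -> i != j -> q i != q j) ->
  forall k l, k <= size w -> l <= size w -> k != l ->
  nested (q k.*2) (q k.*2.+1) (q l.*2) (q l.*2.+1) =
  unlinked (pt w k.*2) (pt w k.*2.+1) (pt w l.*2) (pt w l.*2.+1).
Proof.
move=> h1 h2 k l hk hl nkl; rewrite nested_ncyc; try by apply: h2; lia.
by rewrite /unlinked !(ncyc_order h1) //; lia.
Qed.

Lemma planar_of_arcs w : reduced w -> arcs_unlinked w -> planar (whitehead w).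
Proof.
move=> hw ha; rewrite /planar size_whitehead; set N := (size w).*2.+2.
have hM : N./2 = (size w).+1 by rewrite /N /= doubleK.
have nthp i : i < N -> nth 0 (mkseq (rk w) N) i = rk w i by exact: nth_mkseq.
have neq i j : i < N -> j < N -> i != j -> rk w i != rk w j.
  by move=> hi hj; apply: contra => /eqP /rk_inj ->.
have hs i j : i < N -> j < N -> hsym (pt w i) < hsym (pt w j) -> rk w i < rk w j.
  by move=> hi hj /lt_of_hsym; rewrite -rk_lt.
exists (mkseq (rk w) N); split.
- have un : uniq (mkseq (rk w) N).
    rewrite map_inj_in_uniq ?iota_uniq // => i j; rewrite !mem_iota /= => hi hj.
    exact: rk_inj.
  have sub : {subset mkseq (rk w) N <= iota 0 N}.
    move=> k /mapP[i]; rewrite !mem_iota /= add0n => hi ->; exact: rk_bound.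
  apply: (uniq_perm un (iota_uniq _ _)).
  by apply: (uniq_min_size un sub _).2; rewrite size_iota size_mkseq.
- move=> i j hi hj; rewrite !nthp // rk_lt // !nth_whitehead //.
  exact: lt_hsym.
- move=> i j; rewrite hM => hi hj nij; rewrite !mul2n !nthp /N; try lia.
  by rewrite (nested_order (@rk_lt w) neq) //; exact: ha.
move=> i j; rewrite hM => hi hj nij; rewrite !mul2n !nthp /N; try lia.
(* Two lower arcs over the same pair of symbols are parallel: [low_reverse] orders their ends
   oppositely, and the ranks of [c] and [linv c] keep the left ends apart from the right ends. *)
have same I J : 0 < I < (size w).*2.+1 -> 0 < J < (size w).*2.+1 -> I != J ->
    hsym (pt w I) = hsym (pt w J) -> nested (rk w I) (rk w (low I)) (rk w J) (rk w (low J)).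
  move=> hI hJ nIJ Eh; have [c [EI EI']] := pt_tail hI; have [d [EJ EJ']] := pt_tail hJ.
  have ecd : c = d by apply: rank_inj; move: Eh; rewrite EI EJ.
  subst d.
  have [sI sI'] : hsym (pt w I) = rank c /\ hsym (pt w (low I)) = rank (linv c).
    by rewrite EI EI'.
  have [sJ sJ'] : hsym (pt w J) = rank c /\ hsym (pt w (low J)) = rank (linv c).
    by rewrite EJ EJ'.
  have lI := low_lt hI; have lJ := low_lt hJ.
  have [bI [bI' [bJ bJ']]] : I < N /\ low I < N /\ J < N /\ low J < N by rewrite /N; lia.
  have ord : (rk w I < rk w J /\ rk w (low J) < rk w (low I)) \/
             (rk w J < rk w I /\ rk w (low I) < rk w (low J)).
    have /orP[h|h] := lt_total (ltn0Sn (2 * n).+1) (pt_neq bI bJ nIJ).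
      by left; rewrite !rk_lt // h (low_reverse hw ha hI hJ).
    by right; rewrite !rk_lt // h (low_reverse hw ha hJ hI).
  have sep : (rk w I < rk w (low I) /\ rk w I < rk w (low J) /\
              rk w J < rk w (low I) /\ rk w J < rk w (low J)) \/
             (rk w (low I) < rk w I /\ rk w (low J) < rk w I /\
              rk w (low I) < rk w J /\ rk w (low J) < rk w J).
    case: (ltngtP (rank c) (rank (linv c))) => [h|h|/rank_inj/eqP].
    - by left; rewrite !hs // ?sI ?sJ ?sI' ?sJ'.
    - by right; rewrite !hs // ?sI ?sJ ?sI' ?sJ'.
    - by rewrite eq_sym linv_neq.
  rewrite nestedP; move: ord sep; move: (rk w I) (rk w J) (rk w (low I)) (rk w (low J)).
  by clear => *; lia.
have hI : 0 < i.*2.+1 < (size w).*2.+1 by lia.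
have hJ : 0 < j.*2.+1 < (size w).*2.+1 by lia.
have hJ' : 0 < j.+1.*2 < (size w).*2.+1 by lia.
have [a [Ei Ei']] := pt_tail hI; have [b [Ej Ej']] := pt_tail hJ.
rewrite -doubleS -(low_odd i) -doubleS -(low_odd j).
case: (a =P b) => [eab|nab].
  by apply: same => //; [lia | rewrite Ei Ej eab].
case: (a =P linv b) => [eab|nab'].
  have := same i.*2.+1 j.+1.*2 hI hJ'; rewrite low_even -(low_odd j) nestedCr; apply.
    by rewrite low_odd; lia.
  by rewrite Ei Ej' eab.
have nk : a.1 <> b.1.
  move=> E; case: a b E nab nab' {Ei Ei' Ej Ej'} => k e [l e'] /= ->.
  by rewrite /linv /=; case: e; case: e'.
have bi : i.*2.+1 < N /\ low i.*2.+1 < N /\ j.*2.+1 < N /\ low j.*2.+1 < N.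
  by rewrite !low_odd /N; lia.
case: bi => bI [bI' [bJ bJ']].
have rr (c : letter n) : rank c = (2 * c.1).+1 /\ rank (linv c) = (2 * c.1).+2 \/
            rank c = (2 * c.1).+2 /\ rank (linv c) = (2 * c.1).+1.
  by case: c => k []; rewrite /rank /linv /=; [left|right].
have ra := rr a; have rb := rr b.
have sI : hsym (pt w i.*2.+1) = rank a by rewrite Ei.
have sI' : hsym (pt w (low i.*2.+1)) = rank (linv a) by rewrite Ei'.
have sJ : hsym (pt w j.*2.+1) = rank b by rewrite Ej.
have sJ' : hsym (pt w (low j.*2.+1)) = rank (linv b) by rewrite Ej'.
have nk' : nat_of_ord a.1 <> nat_of_ord b.1 by move/val_inj.
(* A letter and its inverse have consecutive ranks, so lower arcs of different indices lie side by
   side. *)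
have sep : (rk w i.*2.+1 < rk w j.*2.+1 /\ rk w i.*2.+1 < rk w (low j.*2.+1) /\
   rk w (low i.*2.+1) < rk w j.*2.+1 /\ rk w (low i.*2.+1) < rk w (low j.*2.+1)) \/
   (rk w j.*2.+1 < rk w i.*2.+1 /\ rk w (low j.*2.+1) < rk w i.*2.+1 /\
   rk w j.*2.+1 < rk w (low i.*2.+1) /\ rk w (low j.*2.+1) < rk w (low i.*2.+1)).
  case: (ltngtP a.1 b.1) => [h|h|/nk' //]; [left|right].
  - by rewrite !hs // ?sI ?sJ ?sI' ?sJ' {hs neq nthp}; lia.
  - by rewrite !hs // ?sI ?sJ ?sI' ?sJ' {hs neq nthp}; lia.
have nI := neq _ _ bI bI'; have nJ := neq _ _ bJ bJ'.
have {}nI : rk w i.*2.+1 != rk w (low i.*2.+1) by apply: nI; rewrite low_odd; lia.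
have {}nJ : rk w j.*2.+1 != rk w (low j.*2.+1) by apply: nJ; rewrite low_odd; lia.
rewrite nestedP; move: sep nI nJ.
move: (rk w i.*2.+1) (rk w j.*2.+1) (rk w (low i.*2.+1)) (rk w (low j.*2.+1)).
by clear => *; lia.
Qed.

Lemma hsym_interior w i : i < (size w).*2.+2 -> 0 < hsym (pt w i) < z_rank n ->
  0 < i < (size w).*2.+1.
Proof.
move=> hi; case: (posnP i) => [->|i0]; first by rewrite (pt_even w 0) take0.
case: (i =P (size w).*2.+1) => [->|ne _]; last by lia.
by rewrite pt_odd drop_size /hsym /= /z_rank ltnn ?andbF.
Qed.

Lemma hsym_ends w i : i < (size w).*2.+2 -> ~~ (0 < hsym (pt w i) < z_rank n) ->
  pt w i = ([::], hsym (pt w i) == 0).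
Proof.
move=> _; case: (pt w i) => [[|a x] e]; rewrite /hsym /=.
  by case: e.
by rewrite rank_gt0 /z_rank rank_lt.
Qed.

(** The conditions determine the permutation: any witness sorts the points [pt w i] by [lt 0].
    Nesting of the upper arcs then says that they are unlinked. *)
Lemma arcs_of_planar w : reduced w -> planar (whitehead w) -> arcs_unlinked w.
Proof.
move=> hw; rewrite /planar size_whitehead; set N := (size w).*2.+2.
have hM : N./2 = (size w).+1 by rewrite /N /= doubleK.
rewrite hM => -[p [pp hc hU hL]]; pose q i := nth 0 p i.
have szp : size p = N by rewrite (perm_size pp) size_iota.
have up_ : uniq p by rewrite (perm_uniq pp) iota_uniq.
have neq i j : i < N -> j < N -> i != j -> q i != q j.
  by move=> hi hj; rewrite /q nth_uniq ?szp.
have hs i j : i < N -> j < N -> hsym (pt w i) < hsym (pt w j) -> q i < q j.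
  move=> hi hj h; have nij : i != j by apply: contraTneq h => ->; rewrite ltnn.
  have := neq _ _ hi hj nij; rewrite neq_ltn => /orP[//|h'].
  by have := hc _ _ hj hi h'; rewrite !nth_whitehead // leqNgt h.
have hup i j : i < N -> j < N -> i./2 != j./2 ->
    nested (q i) (q (up i)) (q j) (q (up j)).
  rewrite /N => hi hj nij.
  have h := hU i./2 j./2; rewrite !mul2n in h.
  have {}h : nested (q i./2.*2) (q i./2.*2.+1) (q j./2.*2) (q j./2.*2.+1) by apply: h => //; lia.
  move: h; case: (posP i) => -[k E]; case: (posP j) => -[l E'];
    subst i j; rewrite ?up_odd ?up_even ?(half_bit_double _ true) /= ?uphalf_double ?doubleK //.
  - by rewrite nestedCr.
  - by rewrite nestedC.
  - by rewrite nestedC nestedCr.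
have hlow i j : 0 < i < (size w).*2.+1 -> 0 < j < (size w).*2.+1 -> i != j -> i != low j ->
    nested (q i) (q (low i)) (q j) (q (low j)).
  move=> hi hj nij nlow.
  have h := hL i.-1./2 j.-1./2; rewrite !mul2n in h.
  have {}h : i.-1./2 != j.-1./2 -> nested (q i.-1./2.*2.+1) (q i.-1./2.*2.+2) (q j.-1./2.*2.+1) (q j.-1./2.*2.+2).
    by apply: h => //; lia.
  move: h; case: (posP i) => -[k E]; case: (posP j) => -[l E']; subst i j.
  - case: k hi nij nlow => // k hi nij nlow; case: l hj nij nlow => // l hj nij nlow.
    rewrite !low_even !doubleS /= !uphalf_double nestedC nestedCr; apply.
    by lia.
  - case: k hi nij nlow => // k hi nij nlow.
    rewrite !low_even !low_odd in nlow *; rewrite !doubleS /= !uphalf_double doubleK nestedC; apply.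
    by lia.
  - case: l hj nij nlow => // l hj nij nlow.
    rewrite !low_even !low_odd in nlow *; rewrite !doubleS /= !uphalf_double doubleK nestedCr; apply.
    by lia.
  rewrite !low_odd in nlow *; rewrite !doubleS /= !doubleK; apply.
  by lia.
(* For a common first letter [a], the order of [i] and [j] is that of their shorter tails [i2] and
   [j2], cut at [linv a]. The path from [i2] back to [i] runs along an upper arc to [i1] and a lower
   arc to [i], each of which reverses the order. *)
have mono K i j : size (pt w i).1 + size (pt w j).1 < K -> i < N -> j < N ->
    lt 0 (pt w i) (pt w j) -> q i < q j.
  elim: K i j => // K IH i j hK hi hj hlt.
  case: (hsym (pt w i) =P hsym (pt w j)) => [Eh|/eqP nh]; last first.
    by apply: hs => //; rewrite ltn_neqAle nh lt_hsym.
  have [hin|hout] := boolP (0 < hsym (pt w i) < z_rank n); last first.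
    have Ei := hsym_ends hi hout; rewrite Eh in Ei hout.
    by move: hlt; rewrite Ei -(hsym_ends hj hout) lt_irr.
  have ii := hsym_interior hi hin; have jj : 0 < j < (size w).*2.+1.
    by apply: hsym_interior; rewrite -?Eh.
  have [a [Ei Ei']] := pt_tail ii; have [b [Ej Ej']] := pt_tail jj.
  have eab : a = b by apply: rank_inj; move: Eh; rewrite Ei Ej.
  subst b; have nij : i != j by apply: contraTneq hlt => ->; rewrite lt_irr.
  set i1 := low i in Ei Ei'; set j1 := low j in Ej Ej'.
  have li : 0 < i1 < (size w).*2.+1 := low_lt ii.
  have lj : 0 < j1 < (size w).*2.+1 := low_lt jj.
  set i2 := up i1 in Ei; set j2 := up j1 in Ej.
  have si1 : hsym (pt w i1) = rank (linv a) by rewrite Ei'.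
  have sj1 : hsym (pt w j1) = rank (linv a) by rewrite Ej'.
  have ni2 : hsym (pt w i2) != rank (linv a) by rewrite -si1 hsym_up.
  have nj2 : hsym (pt w j2) != rank (linv a) by rewrite -sj1 hsym_up.
  have si : hsym (pt w i) = rank a by rewrite Ei.
  have sj : hsym (pt w j) = rank a by rewrite Ej.
  have bi1 : i1 < N by rewrite /N; lia.
  have bj1 : j1 < N by rewrite /N; lia.
  have bi2 : i2 < N := up_lt bi1.
  have bj2 : j2 < N := up_lt bj1.
  have nij1 : i1 != j1.
    apply: contra nij => /eqP E; apply/eqP; case/andP: ii => i0 _; case/andP: jj => j0 _.
    by apply: etrans (lowK j0); rewrite -/j1 -E /i1 lowK.
  have nhalf : i1./2 != j1./2.
    apply/negP => /eqP /half_up /(_ nij1) E; move: nj2.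
    by rewrite /j2 -E si1 eqxx.
  have nlow : i != low j.
    by apply/eqP => E; move: si; rewrite E sj1 => /rank_inj/eqP; rewrite linv_neq.
  have nest1 := hup _ _ bi1 bj1 nhalf; have nest2 := hlow _ _ ii jj nij nlow.
  rewrite -/i2 -/j2 in nest1; rewrite -/i1 -/j1 in nest2.
  have IH1 := IH i2 j2; have IH2 := IH j2 i2.
  have sz : size (pt w i2).1 + size (pt w j2).1 < K by move: hK; rewrite Ei Ej /=; clear; lia.
  have {}IH1 := IH1 sz bi2 bj2.
  move: hlt; rewrite Ei Ej lt_cons -!surjective_pairing lt_cut; last first.
    by apply: leqW; apply: rank_lt.
  move=> hlt.
  have h12 := hs _ _ bi1 bi2; have h21 := hs _ _ bi2 bi1.
  have g12 := hs _ _ bj1 bj2; have g21 := hs _ _ bj2 bj1.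
  have x12 := hs _ _ bi1 bj2; have x21 := hs _ _ bj2 bi1.
  have y12 := hs _ _ bj1 bi2; have y21 := hs _ _ bi2 bj1.
  rewrite si1 sj1 in h12 h21 g12 g21 x12 x21 y12 y21.
  (* The upper arcs [i1 i2] and [j1 j2] are nested, and [i1], [j1] share the symbol at which the
     order of [i2], [j2] is cut. *)
  have rev : q j1 < q i1.
    case: (ltngtP (rank (linv a)) (hsym (pt w i2))) => hi2; last by rewrite hi2 eqxx in ni2.
    - case: (ltngtP (rank (linv a)) (hsym (pt w j2))) => hj2; last by rewrite hj2 eqxx in nj2.
      + rewrite (ltnW hi2) (ltnW hj2) /= in hlt.
        have := IH1 hlt; have := h12 hi2; have := g12 hj2; have := x12 hj2; have := y12 hi2.
        by move: nest1; rewrite nestedP; clear; lia.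
      + have := h12 hi2; have := g21 hj2; have := x21 hj2; have := y12 hi2.
        by move: nest1; rewrite nestedP; clear; lia.
    - case: (ltngtP (rank (linv a)) (hsym (pt w j2))) => hj2; last by rewrite hj2 eqxx in nj2.
      + by move: hlt; rewrite leqNgt hi2 (ltnW hj2).
      + rewrite (leqNgt _ (hsym (pt w i2))) hi2 (leqNgt _ (hsym (pt w j2))) hj2 /= in hlt.
        have := IH1 hlt; have := h21 hi2; have := g21 hj2; have := x21 hj2; have := y21 hi2.
        by move: nest1; rewrite nestedP; clear; lia.
  case: (ltngtP (rank a) (rank (linv a))) => [hr|hr|/rank_inj/esym/eqP]; last by rewrite linv_neq.
  - have h1 : q i < q i1 by apply: hs; rewrite ?si ?si1.
    have h2 : q i < q j1 by apply: hs; rewrite ?si ?sj1.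
    have h3 : q j < q i1 by apply: hs; rewrite ?sj ?si1.
    have h4 : q j < q j1 by apply: hs; rewrite ?sj ?sj1.
    by move: h1 h2 h3 h4 rev nest2; rewrite nestedP; clear; lia.
  - have h1 : q i1 < q i by apply: hs; rewrite ?si ?si1.
    have h2 : q j1 < q i by apply: hs; rewrite ?si ?sj1.
    have h3 : q i1 < q j by apply: hs; rewrite ?sj ?si1.
    have h4 : q j1 < q j by apply: hs; rewrite ?sj ?sj1.
    by move: h1 h2 h3 h4 rev nest2; rewrite nestedP; clear; lia.
have qlt i j : i < N -> j < N -> (q i < q j) = lt 0 (pt w i) (pt w j).
  move=> hi hj; case: (i =P j) => [->|/eqP ne]; first by rewrite ltnn lt_irr.
  have h0 := ltn0Sn (2 * n).+1.
  have /orP[h|h] := lt_total h0 (pt_neq hi hj ne); first by rewrite h (mono _ _ _ (ltnSn _)).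
  by rewrite (lt_asym h0 h) ltnNge ltnW // (mono _ _ _ (ltnSn _)).
move=> k l hk hl nkl; rewrite -(nested_order qlt neq) // /q.
by have := hU k l; rewrite !mul2n; apply.
Qed.

End Planar.

(** * Arcs next to the central letter *)

Section Reduction.
Variable n : nat.
Implicit Types (x y z u v w g h : word n) (a b c : letter n) (p q r s : point n).

(** For the trivial word the two copies carry the symbols [z_rank] and [0], which are cyclic
    neighbours and stay so in the linear order unless the cut is at [0]. *)
Lemma lt_sign_adjacent (c : nat) u r : (u == [::] -> 0 < c < (2 * n).+2) ->
  lt c (u, false) r -> lt c r (u, true) = false.
Proof.
case: r => x e; elim: u x c => [|a u IH] x c hc h1; apply/negP => h2.
  have {}hc := hc isT; move: h1 h2; have hx := hsym_lt (x, e).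
  case: (@hsym n ([::], false) =P hsym (x, e)) => [E|/eqP N1].
    case: x E {hx} => [|b x]; last first.
      by rewrite /hsym /z_rank /= => E; have := rank_lt b; rewrite -E ltnn.
    by case: e => //; rewrite lt_irr.
  case: (hsym (x, e) =P @hsym n ([::], true)) => [E|/eqP N2].
    case: x E {hx N1} => [|b x]; last first.
      by rewrite /hsym /= => E; have := rank_gt0 b; rewrite E.
    by case: e => //; rewrite lt_irr.
  rewrite (lt_neq _ N1) (lt_neq _ N2) !key_lt ?hsym_lt //; try lia.
  have zE : @hsym n ([::], false) = (2 * n).+1 by [].
  have z0 : @hsym n ([::], true) = 0 by [].
  rewrite zE in N1 *; rewrite z0 in N2 *.
  move: (hsym (x, e)) hx N1 N2 => t ht N1 N2.
  case: (leqP c t) => hct; case: (leqP c (2 * n).+1) => ?; case: (leqP c 0) => ? /=; lia.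
case: (hsym (a :: u, false) =P hsym (x, e)) => [E|/eqP N].
  have /= Ex := hsym_rank (esym E); rewrite Ex !lt_cons in h1 h2.
  rewrite (IH _ _ _ h1) // in h2.
  by move=> _; rewrite rank_gt0; apply: leqW; apply: rank_lt.
have N' : hsym (x, e) != hsym (a :: u, true) by rewrite eq_sym.
move: h1 h2; rewrite (lt_neq _ N) (lt_neq _ N').
by rewrite /hsym /= => h1 h2; have := ltn_trans h1 h2; rewrite ltnn.
Qed.

(* The arcs through the letter [t_i] at the centre of [u^-1 t_i u] end at the adjacent
   points [(b :: u, true)] and [(b :: u, false)], so no arc fits between them.  The
   sign [e] selects one of two mirror images of the argument. *)
Lemma follow_adjacent w (e : bool) a b u k0 : reduced w -> arcs_unlinked w ->
  0 < k0 < (size w).*2.+1 ->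
  pt w k0 = (a :: b :: u, e) -> pt w (up k0) = (b :: u, ~~ e) ->
  (if e then rank a = (rank (linv a)).+1 /\ rank (linv a) = (rank b).+1
   else rank (linv a) = (rank a).+1 /\ rank b = (rank (linv a)).+1) ->
  forall k, k < (size w).*2.+2 -> hsym (pt w k) = rank (linv a) ->
  hsym (pt w (up k)) = rank b.
Proof.
move=> hw ha hk0 E0 E1 hr.
(* With the order reversed for [e = true], the symbols [a], [linv a], [b] are consecutive and
   increasing in both cases. *)
pose o p q := if e then lt 0 q p else lt 0 p q.
have h0 := ltn0Sn (2 * n).+1.
have o_irr p : o p p = false by rewrite /o; case: (e); exact: lt_irr.
have o_asym p q : o p q -> o q p = false by rewrite /o; case: (e); exact: lt_asym.
have o_total p q : p != q -> o p q || o q p.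
  by move=> ne; rewrite /o; case: (e); rewrite ?(orbC (lt 0 q p)); exact: lt_total.
have o_unl p q r s : p != q -> p != r -> p != s -> q != r -> q != s -> unlinked p q r s ->
   ([|| o p r && o r q, o r q && o q p | o q p && o p r]) =
   ([|| o p s && o s q, o s q && o q p | o q p && o p s]).
  move=> n1 n2 n3 n4 n5; rewrite /o; case: (e); last by move/eqP.
  rewrite -(unlinkedC n1 n2 n3 n4 n5) => /eqP; rewrite /cyc => E.
  move: E; case: (lt 0 q r); case: (lt 0 r p); case: (lt 0 p q);
  by case: (lt 0 q s); case: (lt 0 s p).
pose hs p := if e then (2 * n).+1 - hsym p else hsym p.
have o_hs p q : o p q -> hs p <= hs q.
  by rewrite /o /hs; case: (e) => /lt_hsym; have := hsym_lt p; have := hsym_lt q; lia.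
have hs_o p q : hs p < hs q -> o p q.
  by rewrite /o /hs; case: (e) => h; apply: lt_of_hsym; have := hsym_lt p; have := hsym_lt q; lia.
have [a' [Ea' Ek1]] := pt_tail hk0.
have ea : a' = a by move: Ea'; rewrite E0 => -[].
subst a'; set k1 := low k0 in Ek1 Ea'; rewrite E1 /= in Ek1.
have EU1 : pt w (up k1) = (b :: u, e).
  by rewrite [LHS]surjective_pairing; move: Ea'; rewrite E0 => -[<- <-].
have lk1 : 0 < k1 < (size w).*2.+1 := low_lt hk0.
set T := pt w k0; set U2 := pt w (up k0); set Y := pt w k1; set U1 := pt w (up k1).
have sT : hsym T = rank a by rewrite /T E0.
have sU2 : hsym U2 = rank b by rewrite /U2 E1.
have sY : hsym Y = rank (linv a) by rewrite /Y Ek1.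
have sU1 : hsym U1 = rank b by rewrite /U1 EU1.
have ba := rank_lt a; have bb := rank_lt b; have baV := rank_lt (linv a).
pose f (x : nat) := if e then (2 * n).+1 - x else x.
have hsE p : hs p = f (hsym p) by [].
have f1 : f (rank (linv a)) = (f (rank a)).+1 by rewrite /f; move: hr; case: (e); lia.
have f2 : f (rank b) = (f (rank a)).+2 by rewrite /f; move: hr; case: (e); lia.
have f_inj (x y : nat) : x < (2 * n).+2 -> y < (2 * n).+2 -> f x = f y -> x = y.
  by rewrite /f; case: (e); lia.
have rneq : rank (linv a) != rank a /\ rank (linv a) != rank b.
  by move: hr; case: (e); lia.
have bk0 : k0 < (size w).*2.+2 by lia.
have bk1 : k1 < (size w).*2.+2 by lia.
have buk0 := up_lt bk0; have buk1 := up_lt bk1.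
(* [U1] and [U2] are the two copies of the base point [b :: u], with [U1] first in the order [o]. *)
have adj q : o U1 q -> o q U2 = false.
  rewrite /o /U1 /U2 EU1 E1; case: (e) => h; last exact: lt_sign_adjacent h.
  by apply/negP => h'; rewrite (lt_sign_adjacent _ h') in h.
have other k : k < (size w).*2.+2 -> hsym (pt w k) = rank (linv a) -> k != k1 ->
    k./2 != k0./2 /\ k./2 != k1./2.
  move=> hk sk nk; split; apply/negP => /eqP E.
    case: (k =P k0) => [E'|/eqP ne]; first by move: sk rneq.1; rewrite E' sT => ->; rewrite eqxx.
    have E' := half_up E ne; move: sk rneq.2; rewrite E' sU2 => ->; by rewrite eqxx.
  by have E' := half_up E nk; move: sk rneq.2; rewrite E' sU1 => ->; rewrite eqxx.
have neq k l : k < (size w).*2.+2 -> l < (size w).*2.+2 -> k./2 != l./2 -> pt w k != pt w l.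
  by move=> hk hl nkl; apply: pt_neq => //; apply: contraNneq nkl => ->.
(* A point with symbol [linv a] lies between [T] and [U2]; its arc is unlinked from that of [T] and
   [U2], so its other end lies there too. *)
have btw k : k < (size w).*2.+2 -> hsym (pt w k) = rank (linv a) -> k != k1 ->
    o T (pt w (up k)) /\ o (pt w (up k)) U2.
  move=> hk sk nk; have [n0 n1] := other _ hk sk nk.
  have buk := up_lt hk.
  have unl := arcs_up ha bk0 hk (negbT (introF eqP (nesym (elimN eqP n0)))).
  rewrite -/T -/U2 in unl.
  have d1 : T != pt w (up k) by rewrite eq_sym neq // up_half.
  have d2 : U2 != pt w (up k) by rewrite eq_sym neq // !up_half.
  have d3 : T != pt w k by rewrite eq_sym neq.
  have d4 : U2 != pt w k by rewrite eq_sym neq // up_half.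
  have d5 : U2 != T by apply/eqP => E; move: sT; rewrite -E sU2; move: hr; case: (e); clear; lia.
  have := o_unl _ _ _ _ d5 d2 d4 d1 d3 unl.
  have oTp : o T (pt w k) by apply: hs_o; rewrite !hsE ?sT ?sk ?sU2 ?sY ?sU1 ?f1 ?f2.
  have opU : o (pt w k) U2 by apply: hs_o; rewrite !hsE ?sT ?sk ?sU2 ?sY ?sU1 ?f1 ?f2.
  have oTU : o T U2 by apply: hs_o; rewrite !hsE ?sT ?sk ?sU2 ?sY ?sU1 ?f1 ?f2.
  rewrite oTU (o_asym _ _ opU) (o_asym _ _ oTp) /= ?andbF ?andbT /=.
  have := o_total _ _ d1; have := o_total _ _ d2.
  by case: (o T _); case: (o _ T); case: (o _ U2); case: (o U2 _).
move=> k hk sk; have [K hK] := ubnP (size (pt w (up k)).1).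
elim: K k hk sk hK => // K IH k hk sk hK.
case: (k =P k1) => [->|/eqP nk]; first exact: sU1.
have [n0 n1] := other _ hk sk nk; have [oTq oqU] := btw _ hk sk nk.
have buk := up_lt hk.
have nq : hsym (pt w (up k)) != rank (linv a).
  by rewrite -sk hsym_up //; apply: hsym_interior; rewrite // sk rank_gt0.
have unl := arcs_up ha bk1 hk (negbT (introF eqP (nesym (elimN eqP n1)))).
rewrite -/Y -/U1 in unl.
have d1 : Y != pt w (up k) by rewrite eq_sym neq // up_half.
have d2 : U1 != pt w (up k) by rewrite eq_sym neq // !up_half.
have d3 : Y != pt w k by rewrite eq_sym neq.
have d4 : U1 != pt w k by rewrite eq_sym neq // up_half.
have d5 : U1 != Y by apply/eqP => E; move: sY; rewrite -E sU1; move: hr; case: (e); clear; lia.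
have cE := o_unl _ _ _ _ d5 d2 d4 d1 d3 unl.
have opU : o (pt w k) U1 by apply: hs_o; rewrite !hsE ?sT ?sk ?sU2 ?sY ?sU1 ?f1 ?f2.
have oYU : o Y U1 by apply: hs_o; rewrite !hsE ?sT ?sk ?sU2 ?sY ?sU1 ?f1 ?f2.
have oqU1 : o (pt w (up k)) U1.
  by have /orP[/adj|//] := o_total _ _ d2; rewrite oqU.
have hq := hsym_lt (pt w (up k)).
have /orP[oYq|oqY] := o_total _ _ d1.
  have := o_hs _ _ oYq; have := o_hs _ _ oqU1; rewrite !hsE sY sU1 => h1 h2.
  apply: (f_inj _ _) => //; first exact: leqW.
  have : f (hsym (pt w (up k))) != f (rank (linv a)).
    by apply: contra nq => /eqP /(f_inj _ _ hq (leqW baV)) ->.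
  by move: h1 h2; rewrite ?f2 f1; clear; lia.
(* The remaining case: the arc comes back through the side [a]. Its continuation in the next tile
   again has an end with symbol [linv a], and its other end is shorter, so the induction applies. *)
have sq : hsym (pt w (up k)) = rank a.
  have := o_hs _ _ oTq; have := o_hs _ _ oqY; rewrite !hsE sY sT => h1 h2.
  apply: (f_inj _ _) => //; first exact: leqW.
  have : f (hsym (pt w (up k))) != f (rank (linv a)).
    by apply: contra nq => /eqP /(f_inj _ _ hq (leqW baV)) ->.
  by move: h1 h2; rewrite ?f2 f1; clear; lia.
have iuk : 0 < up k < (size w).*2.+1 by apply: hsym_interior; rewrite // sq rank_gt0.
have [a' [Eq Eq']] := pt_tail iuk.
have ea : a' = a by apply: rank_inj; rewrite -sq Eq.
subst a'; set k' := low (up k) in Eq Eq'.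
have bk' : k' < (size w).*2.+2 by have := low_lt iuk; rewrite -/k'; clear; lia.
have sk' : hsym (pt w k') = rank (linv a) by rewrite Eq'.
have sq' : hsym (pt w (up k')) = rank b.
  by apply: IH => //; move: hK; rewrite Eq.
(* Cancelling [a] in the comparison of [T] with [pt w (up k)] puts the new end after [U1], whereas
   [btw] puts it before [U2]: there is no room. *)
have oU1q' : o U1 (pt w (up k')).
  move: oTq; rewrite /o /T E0 Eq /U1 EU1; case: (e); rewrite lt_cons -surjective_pairing.
    by rewrite (lt_eq _ 0) // sq'.
  by rewrite (lt_eq _ 0) // sq'.
case: (k' =P k1) => [E|/eqP nk']; first by rewrite E o_irr in oU1q'.
have [_] := btw _ bk' sk' nk'; by rewrite (adj _ oU1q').
Qed.

End Reduction.

(** * Descent *)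

Section Descent.
Variable n : nat.
Implicit Types (x y z u v w g h : word n) (a b c : letter n) (i j k : 'I_n).

(** A [linv a] at the head of [v] is exempt, so that the property passes to suffixes. *)
Definition follows a b v :=
  (forall x y, v = x ++ a :: y -> exists y', y = b :: y') /\
  (forall x y, v = x ++ linv a :: y -> x != [::] -> exists x', x = rcons x' (linv b)).

Lemma follows_catr a b x v : follows a b (x ++ v) -> follows a b v.
Proof.
case=> h1 h2; split=> y z E; first by apply: (h1 (x ++ y)); rewrite E catA.
case/lastP: y E => // y c E _.
have [||x' Ex'] := h2 (x ++ rcons y c) z; first by rewrite E catA.
  by case: (x) => //; case: (y).
by exists y; move: Ex'; rewrite -rcons_cat => /rcons_inj [_ ->].
Qed.

(** The condition on ranks says that [b] is [t_(i+1)] if [a = t_i], and [t_(i-1)^-1] if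
    [a = t_i^-1]. The two cases apply [follow_adjacent] just before and just after the central
    letter. *)
Lemma follows_center i a b u : reduced (conjw (b :: u) i) ->
  arcs_unlinked (conjw (b :: u) i) -> a.1 = i ->
  (if a.2 then rank (linv a) = (rank a).+1 /\ rank b = (rank (linv a)).+1
   else rank a = (rank (linv a)).+1 /\ rank (linv a) = (rank b).+1) ->
  follows a b (conjw (b :: u) i).
Proof.
set w := conjw _ _ => hw ha ai hr.
have szw : size w = (size u).+1 + (size u).+2 by rewrite /w /conjw size_cat size_winv.
have sz1 : (size u).+1 = size (winv (b :: u)) by rewrite size_winv.
have tk : take (size u).+1 w = winv (b :: u).
  by rewrite sz1 /w /conjw take_size_cat.
have dr : drop (size u).+1 w = (i, true) :: b :: u.
  by rewrite sz1 /w /conjw drop_size_cat.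
have tk' : take (size u).+2 w = winv (b :: u) ++ [:: (i, true)].
  rewrite /w /conjw -[_ :: b :: u]cat1s catA.
  by rewrite take_size_cat // size_cat size_winv addn1.
have dr' : drop (size u).+2 w = b :: u.
  rewrite /w /conjw -[_ :: b :: u]cat1s catA.
  by rewrite drop_size_cat // size_cat size_winv addn1.
have key : forall k : nat, k < (size w).*2.+2 -> hsym (pt w k) = rank (linv a) ->
    hsym (pt w (up k)) = rank b.
  case: a ai hr => l [] /= -> hr.
    apply: (@follow_adjacent _ w false (i, true) b u (size u).+1.*2.+1) => //.
    - by rewrite szw; lia.
    - by rewrite pt_odd dr.
    - by rewrite up_odd pt_even tk winvK.
  apply: (@follow_adjacent _ w true (i, false) b u (size u).+2.*2) => //.
  - by rewrite szw; lia.
  - by rewrite pt_even tk' winv_cat winvK.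
  - by rewrite up_even pt_odd dr'.
split=> x y Ew.
  have := key (size x).+1.*2; rewrite up_even pt_even pt_odd Ew -cat_rcons.
  rewrite -(size_rcons x a) take_size_cat // drop_size_cat // -cats1 winv_cat.
  move=> h; have /hsym_rank /= -> : hsym (y, false) = rank b.
    by apply: h => //; rewrite !size_cat /=; lia.
  by exists (behead y).
move=> _; have := key (size x).*2.+1; rewrite up_odd pt_even pt_odd Ew.
rewrite take_size_cat // drop_size_cat // => h.
have /hsym_rank /= E : hsym (winv x, true) = rank b.
  by apply: h => //; rewrite size_cat /=; lia.
exists (winv (behead (winv x))).
by rewrite -{1}(winvK x) {1}E winv_cons cats1.
Qed.

Definition cnt i v := count (fun c : letter n => c.1 != i) v.

(** The pair [a b] goes to [a b a^-1 a = a b], its inverse is likewise fixed, and every letter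
    outside such pairs goes to one letter. A pair counts once on either side: through [b] before and
    through [a] after. *)
Lemma shrink f a b v : a.1 != b.1 -> subw f [:: b] = [:: a] ->
  subw f [:: a] = [:: a; b; linv a] ->
  (forall c, c.1 != a.1 -> c.1 != b.1 -> subw f [:: c] = [:: c]) ->
  follows a b v -> (forall y, v <> linv a :: y) ->
  exists v', eqv v' (subw f v) /\ cnt b.1 v' <= cnt a.1 v.
Proof.
move=> nab fb fa fc.
have fbV : subw f [:: linv b] = [:: linv a] by rewrite subw1V fb.
have faV : subw f [:: linv a] = [:: a; linv b; linv a].
  by rewrite subw1V fa /winv /= linvK.
have lin1 c : (linv c).1 = c.1 by [].
have nba : b.1 != a.1 by rewrite eq_sym.
have [K] := ubnP (size v); elim: K v => // K IH [|c v] hK hf hh; first by exists [::].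
have sub x y : follows a b (x ++ y) -> follows a b y := @follows_catr a b x y.
case: (c =P a) => [ca|nca].
  subst c; have [y' Ey] := hf.1 [::] v erefl; subst v.
  have [|y Ey|v' [E hv]] := IH y' _ (sub [:: a; b] _ hf).
  - by rewrite /= in hK; lia.
  - have [|//|x' Ex] := hf.2 [:: a; b] y; first by rewrite Ey.
    have := congr1 (last a) Ex; rewrite last_rcons /= => /eqP.
    by rewrite eq_sym linv_neq.
  exists (a :: b :: v'); split; last by rewrite /cnt /= !eqxx nab nba /= in hv *; lia.
  rewrite (subw_cons f a) (subw_cons f b) fa fb.
  apply: (@eqv_cat _ [:: a; b] [:: a; b] v') => //=.
  by rewrite /eqv (@reduce_winvl _ [:: a]).
have hc : c.1 != a.1.
  apply/eqP => E; have : c = linv a.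
    case: (c) (a) nca E => k s [l t] /= nca E; subst l; rewrite /linv /=.
    by move: nca; case: s; case: t.
  by move=> Ec; case: (hh v); rewrite Ec.
have [d Ed] : exists d, subw f [:: c] = [:: d].
  have [cb|ncb] := boolP (c.1 == b.1); last by exists c; exact: fc.
  have [->|->] : c = b \/ c = linv b; [|by exists a|by exists (linv a)].
  move: cb; case: (c) (b) => k s [l t] /= /eqP ->.
  by rewrite /linv /=; case: s; case: t; [left|right|right|left].
(* An inverse pair is consumed as a whole, so the recursion never meets a leading [linv a]. *)
have [[cb [v1 Ev]]|nsp] : (c = linv b /\ exists v1, v = linv a :: v1) \/ (forall y, v <> linv a :: y).
- case: v hK hf {hh} => [|e v] hK hf; first by right.
  case: (e =P linv a) => [Ee|ne]; last by right=> y [].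
  left; split; last by exists v; rewrite Ee.
  have [|//|x' Ex] := hf.2 [:: c] v; first by rewrite Ee.
  by have := congr1 (last c) Ex; rewrite last_rcons.
- subst c v.
  have [|y Ey|v' [E hv]] := IH v1 _ (sub [:: linv b; linv a] _ hf).
  + by rewrite /= in hK; lia.
  + have [|//|x' Ex] := hf.2 [:: linv b; linv a] y; first by rewrite Ey.
    have := congr1 (last a) Ex; rewrite last_rcons /= => E.
    by move: nab; rewrite -(lin1 a) E lin1 eqxx.
  exists (linv b :: linv a :: v'); split; last first.
    by move: hv; rewrite /cnt /= ?lin1 !eqxx nab nba /=; lia.
  rewrite (subw_cons f (linv b)) (subw_cons f (linv a)) fbV faV.
  symmetry; apply: etrans (@reduce_winvl _ [:: a] _) _ => /=.
  by apply: (@eqv_cat _ [:: linv b; linv a] [:: linv b; linv a]).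
have [|v' [E hv]] := IH v _ (sub [:: c] _ hf) nsp; first by rewrite /= in hK; lia.
exists (d :: v'); split; last first.
  by rewrite /cnt /= hc in hv *; case: (d.1 != b.1); lia.
by rewrite (subw_cons f c) Ed; apply: (@eqv_cat _ [:: d] [:: d]).
Qed.

Lemma subseq_push a v : subseq (push a v) (a :: v).
Proof.
case: v => [|b v]; first exact: subseq_refl.
rewrite [push _ _]/=; case: ifP => _; last exact: subseq_refl.
exact: subseq_trans (subseq_cons v b) (subseq_cons _ a).
Qed.

Lemma subseq_reduce v : subseq (reduce v) v.
Proof.
elim: v => // a v IH; rewrite reduce_cons; apply: subseq_trans (subseq_push _ _) _.
by rewrite /= eqxx.
Qed.

Lemma subseq_strip i v : subseq (strip i v) v.
Proof. by have [h [E _]] := strip_suffix i v; rewrite {2}E suffix_subseq. Qed.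

Lemma cnt_subseq i u v : subseq u v -> cnt i u <= cnt i v.
Proof. by rewrite /cnt; exact: leq_count_subseq. Qed.

Lemma cnt_strip_reduce i v : cnt i (strip i (reduce v)) <= cnt i v.
Proof. exact: cnt_subseq (subseq_trans (subseq_strip _ _) (subseq_reduce _)). Qed.

Definition nonidx i := [pred c : letter n | c.1 != i].

Lemma filter_subseq_eq i u v : subseq u v -> cnt i v <= cnt i u ->
  filter (nonidx i) u = filter (nonidx i) v.
Proof.
move=> hs hc; apply/eqP.
have h : subseq (filter (nonidx i) u) (filter (nonidx i) v).
  by rewrite subseq_filter filter_all (subseq_trans (filter_subseq _ _) hs).
by rewrite -(size_subseq_leqif h) eqn_leq (size_subseq h) !size_filter.
Qed.

(** The relabelling of the rays when punctures [i] and [i'] trade places. *)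
Definition relabel i i' c : letter n := (tperm i i' c.1, c.2).

(** Before reduction the counted letters of [u] correspond one to one, in order, to those of its
    image. If the count does not drop, no counted letter is lost, so the head of [u] survives
    relabelled. *)
Lemma move_step f i i' u : subw f [:: (i, true)] = [:: (i', true)] ->
  (forall c, filter (nonidx i') (subw f [:: c]) = if c.1 == i then [::] else [:: relabel i i' c]) ->
  exists u', [/\ reduced (conjw u' i'), ext f (conjw u i) = conjw u' i', cnt i' u' <= cnt i u &
    cnt i u <= cnt i' u' ->
      if u is c :: _ then c.1 != i -> exists u2, u' = relabel i i' c :: u2 else u' = [::]].
Proof.
move=> fi fc; set v := subw f u.
have fE x : filter (nonidx i') (subw f x) = map (relabel i i') (filter (nonidx i) x).
  elim: x => // c x IH; rewrite subw_cons filter_cat IH fc /=.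
  by case: (c.1 == i).
have cE : cnt i' v = cnt i u by rewrite /cnt -!size_filter fE size_map.
exists (strip i' (reduce v)); split.
- exact/reduced_conjw_strip/reduced_reduce.
- rewrite extE /conjw subw_cat (subw_cons f (i, true)) fi subw_winv -/v.
  rewrite -[LHS]/(reduce (conjw v i')) -[RHS](reduce_id (reduced_conjw_strip i' (reduced_reduce v))).
  by apply/esym; apply: etrans (conjw_strip _ _) _; apply: eqv_conjw; exact: eqv_reduce.
- by rewrite -cE cnt_strip_reduce.
rewrite -cE => hle.
have := filter_subseq_eq (subseq_trans (subseq_strip i' (reduce v)) (subseq_reduce v)) hle.
rewrite fE; case: (strip i' (reduce v)) (@strip_head n i' (reduce v)) => [|d u'] hd /=.
  by case: (u) => // c x /= E hc; move: E; rewrite hc.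
have -> : d.1 != i' by apply/eqP => E; case: (hd d.2 u'); rewrite -E -surjective_pairing.
case: (u) => [//|c x] /= E hc; move: E; rewrite hc => -[-> _]; by exists u'.
Qed.

End Descent.

(** * The orbit of the first generator *)

Section Main.
Variable n : nat.
Implicit Types (x y z u v w g h : word n) (a b c : letter n) (i j k : 'I_n).

Lemma in_Bn_conjw (f : 'I_n -> word n) : in_Bn f -> forall k, exists s u,
  reduced (conjw u s) /\ eqv (f k) (conjw u s).
Proof.
case=> _ _ [s hs] k; exists (s k); have [g [hg E]] := hs k.
have [u [h1 h2 _]] := conjw_normal (s k) (winv g); exists u; split=> //.
rewrite /eqv h2 /conjw winvK.
have E' : reduce (winv g ++ f k ++ g) = gen (s k).
  by rewrite -E extE subw_gen conj_reduce.
rewrite -(cat1s _ (winv g)) -[[:: (s k, true)]]/(gen (s k)) -E'.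
rewrite -(reduce_catr g) reduce_catl reduce_catr -!catA reduce_winvr.
by rewrite -[in RHS](reduce_catr (f k)) -(cats0 (winv g)) reduce_winvr cats0.
Qed.

Lemma in_Bn_monotone (f : 'I_n -> word n) : in_Bn f -> monotone f.
Proof.
move=> hf; have hc k : exists su : 'I_n * word n,
    reduced (conjw su.2 su.1) /\ eqv (f k) (conjw su.2 su.1).
  by have [s [u h]] := in_Bn_conjw hf k; exists (s, u).
have [su h] := fin_all_exists hc; case: hf => _ hz _.
apply: (@artin_monotone n f (fun k => (su k).1) (fun k => (su k).2)) => [k|k|].
- by case: (h k).
- by case: (h k).
exact: ext_tprod.
Qed.

Lemma cred_conjw u i (k : nat) : size (conjw u i) <= k -> cred k (conjw u i) = gen i.
Proof.
elim/last_ind: u k => [|u c IH] k.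
  by case: k => [|k]; rewrite /conjw /=.
case: k => [|k]; first by rewrite /conjw size_cat /= addnS.
have E : conjw (rcons u c) i = linv c :: rcons (conjw u i) c.
  by rewrite -cats1 /conjw winv_cat /= -cat_cons -cats1 -catA.
rewrite E /= size_rcons last_rcons linvK eqxx belast_rcons /= => h.
have -> : rcons (conjw u i) c != [::] by case: (conjw u i).
by apply: IH; lia.
Qed.

Lemma cred_eq_gen (k : nat) w i : cred k w = gen i -> exists u, w = conjw u i.
Proof.
elim: k w => [|k IH] w /=; first by move=> ->; exists [::].
case: w => // c r; case: ifP => [|_ ->]; last by exists [::].
case/lastP: r => // r d; rewrite last_rcons belast_rcons /= => /andP[_ /eqP ->] /IH [u ->].
exists (rcons u (linv c)).
by rewrite -!cats1 /conjw winv_cat -!catA {1}/winv /= linvK.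
Qed.

Lemma reduce_rcons v a : reduced v ->
  reduce (v ++ [:: a]) = if v is b :: v' then
     if last b v' == linv a then take (size v') v else rcons v a else [:: a].
Proof.
move=> hv; case/lastP: v hv => // v b hv.
have -> : (if rcons v b is b0 :: v' then if last b0 v' == linv a then take (size v') (rcons v b)
    else rcons (rcons v b) a else [:: a]) =
    if b == linv a then v else rcons (rcons v b) a.
  case: v {hv} => //= c v; rewrite last_rcons size_rcons; case: ifP => // _.
  by rewrite -rcons_cons -cats1 take_size_cat.
case: (b =P linv a) => [->|ne].
  have hv' : reduced v by move: hv; rewrite -cats1 => /reduced_catl.
  have E : eqv [:: linv a; a] [::] by rewrite /eqv /= linvK eqxx.
  by rewrite -cats1 -catA; apply: etrans (eqv_cat erefl E) _; rewrite cats0 reduce_id.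
rewrite cats1; apply: reduce_id; rewrite reduced_rcons2 hv andbT.
by apply/eqP => E; apply: ne; rewrite E linvK.
Qed.

Lemma sig_move i j c : j = i.+1 :> nat ->
  filter (nonidx j) (subw (sig i j) [:: c]) = if c.1 == i then [::] else [:: relabel i j c].
Proof.
move=> ij; have [nij nji] := ord_neq_succ ij.
case: c => k s; rewrite /subw /= cats0 /sig /relabel /=.
case: (k =P i) => [_|/eqP ki]; first by case: s; rewrite /= eqxx.
case: (k =P j) => [->|/eqP kj].
  by rewrite tpermR; case: s; rewrite /= eqxx /= nij.
by rewrite tpermD 1?eq_sym //; case: s; rewrite /= kj.
Qed.

Lemma sigV_move i j c : j = i.+1 :> nat ->
  filter (nonidx i) (subw (sigV i j) [:: c]) = if c.1 == j then [::] else [:: relabel j i c].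
Proof.
move=> ij; have [nij nji] := ord_neq_succ ij.
case: c => k s; rewrite /subw /= cats0 /sigV /relabel /=.
case: (k =P j) => [_|/eqP kj]; first by case: s; rewrite /= eqxx.
case: (k =P i) => [->|/eqP ki].
  by rewrite tpermR; case: s; rewrite /= eqxx /= nji.
by rewrite tpermD 1?eq_sym //; case: s; rewrite /= ki.
Qed.

Lemma conjw_head i c u : reduced (conjw (c :: u) i) -> c.1 != i.
Proof.
rewrite /conjw reduced_cat_cons winv_cons cats1 reduced_rcons2 reduced_cons2.
case/andP=> /andP[h1 _] /andP[h2 _]; apply/eqP => E.
by move: h1 h2; rewrite linvK; case: c E => k [] /= ->; rewrite /linv /= !eqxx.
Qed.

(** The image of [t_i] is [a t_(b.1) a^-1] and that of the head [b] is [a], so they cancel and only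
    the image of [u] conjugates. The count drops because [b] has been absorbed. *)
Lemma shrink_step (f : 'I_n -> word n) i a b u : reduced (conjw (b :: u) i) ->
  a.1 = i -> b.1 != i -> b.2 = a.2 -> follows a b (conjw (b :: u) i) ->
  subw f [:: b] = [:: a] -> subw f [:: a] = [:: a; b; linv a] ->
  (forall c, c.1 != a.1 -> c.1 != b.1 -> subw f [:: c] = [:: c]) ->
  exists u', [/\ reduced (conjw u' b.1), ext f (conjw (b :: u) i) = conjw u' b.1 &
    cnt b.1 u' < cnt i (b :: u)].
Proof.
move=> hr ai bi bs hf fb fa fc.
have nab : a.1 != b.1 by rewrite ai eq_sym.
have Ew : conjw (b :: u) i = (winv (b :: u) ++ [:: (i, true); b]) ++ u.
  by rewrite /conjw -catA.
have fu : follows a b u by move: hf; rewrite Ew => /follows_catr.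
have hu y : u <> linv a :: y.
  move=> Eu; have [||x' Ex] := hf.2 (winv (b :: u) ++ [:: (i, true); b]) y.
  - by rewrite Ew Eu.
  - by case: (winv _).
  have := congr1 (last b) Ex; rewrite last_cat last_rcons /= => /eqP.
  by rewrite eq_sym linv_neq.
have [v [Ev hv]] := shrink nab fb fa fc fu hu.
have ft : subw f [:: (i, true)] = [:: a; (b.1, true); linv a].
  case: a ai bs fb fa {nab hf fc fu hu hv} => k s /= -> bs fb fa.
  case: s fa bs fb => fa bs fb; first by rewrite fa [b]surjective_pairing bs.
  have := subw1V f (i, false); rewrite fa => ->.
  have Eb : linv b = (b.1, true) by rewrite /linv bs.
  by rewrite /winv /= /rev /= linvK Eb.
exists (strip b.1 (reduce v)); split.
- exact/reduced_conjw_strip/reduced_reduce.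
- rewrite -[RHS](reduce_id (reduced_conjw_strip b.1 (reduced_reduce v))).
  rewrite conjw_strip (eqv_conjw _ (eqv_reduce v)) (eqv_conjw _ Ev) extE.
  rewrite {1}/conjw subw_cat (subw_cons f (i, true)) (subw_cons f b) subw_winv (subw_cons f b).
  rewrite ft fb winv_cat -catA; apply: eqv_cat => //.
  apply: etrans (@reduce_winvl _ [:: a] _) _.
  apply: (@eqv_cat _ [:: (b.1, true)] [:: (b.1, true)]) => //.
  exact: (@reduce_winvl _ [:: a]).
have := leq_trans (cnt_strip_reduce b.1 v) hv; rewrite ai => h.
by rewrite [X in _ < X]/cnt /= bi add1n ltnS.
Qed.

Section First.
Hypothesis hn : 0 < n.
Let o := Ordinal hn.

Definition below_t1 v := if v is a :: b :: _ then (a == (o, true)) && (b.1 != o) else false.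

(** After [t_1] the order is cut at [t_1^-1], and the end of [t_1] carries the symbol [z_1]: the
    tails below it are those whose first letter is not [t_1^{+-1}]. *)
Lemma lt_t1 v e : reduced v -> (v, e) != ([::], true) ->
  lt 0 (v, e) (gen o, false) = below_t1 v.
Proof.
have rt : rank (o, true) = 1 by [].
have rtV : rank (linv (o, true)) = 2 by [].
move=> hv ne; case: v hv ne => [|a v] hv ne.
  by case: e ne => // _; rewrite lt_neq /hsym /= ?rt /key /z_rank //=; lia.
case: (a =P (o, true)) => [Ea|na]; last first.
  have nr : rank a != 1 by rewrite -rt (inj_eq (@rank_inj n)); apply/eqP.
  rewrite lt_neq /hsym /= ?rt // /key /= !subn0.
  have -> : (rank a < 1) = false by have := rank_gt0 a; lia.
  by case: (v) => //= b _; rewrite (introF eqP na).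
subst a; rewrite lt_cons rtV; have := hsym_reduced e hv; rewrite rtV.
have hn2 : 2 < (2 * n).+2 by lia.
have hz : @hsym n ([::], false) = (2 * n).+1 by [].
case: v hv {ne} => [|b v] hv.
  case: e => _; last by rewrite lt_irr.
  have hz0 : @hsym n ([::], true) = 0 by [].
  have h3 : 2 <= (2 * n).+1 by lia.
  by rewrite lt_neq ?hz ?hz0 // key_lt // h3.
have nb : hsym (b :: v, e) != @hsym n ([::], false).
  by rewrite hz /hsym /=; have := rank_lt b; lia.
rewrite lt_neq // key_lt ?hsym_lt // hz /hsym /= ?eqxx /= => n2.
have hb := rank_lt b; have hb0 := rank_gt0 b.
have -> : 2 <= (2 * n).+1 by lia.
have -> : (b.1 != o) = (2 < rank b).
  case: (b) n2 hb0 => k s; rewrite /rank /= -val_eqE /=.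
  by case: s; lia.
by case: (leqP 2 (rank b)) => /=; lia.
Qed.

(** Right multiplication by [t_1] does not affect [below_t1], so both ends of a translate are on the
    same side of the arc. *)
Lemma simple_t1 : simple (gen o).
Proof.
move=> g hg ng; rewrite /unlinked.
have h1 : hsym (g, true) != 0.
  by case: (g) ng => // a v _; rewrite /hsym /= -lt0n rank_gt0.
have h2 v : hsym (v, false) != 0.
  by case: v => // a v; rewrite /hsym /= -lt0n rank_gt0.
rewrite !cyc_base // !lt_t1 ?reduced_reduce //; last first.
- by apply: contra ng => /eqP [->].
- by apply/eqP => -[].
rewrite reduce_rcons //; case: g hg ng {h1} => [|a [|b v]] //= hg _.
  by case: ifP => //= _; rewrite ?andbF ?eqxx ?andbF.
case: ifP => // /eqP E; case: v E hg => [|d v] //= E hg.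
by rewrite E eqxx andbF.
Qed.

Definition in_orbit w := exists f : 'I_n -> word n, in_Bn f /\ ext f (gen o) = w.

Lemma in_orbit_back (f g : 'I_n -> word n) w :
  in_Bn g -> invw f g -> reduced w -> in_orbit (ext f w) -> in_orbit w.
Proof.
move=> hg fg hw [h [hh E]]; exists (compw h g); split; first exact: in_Bn_comp.
by rewrite ext_compw E fg.
Qed.

(* The number of neighbours over which the puncture [i] has to pass before it is
   adjacent to the side of the ray that [u] crosses first. *)
Definition dist i u : nat :=
  if u is c :: _ then
    if c.2 then (if i < c.1 then c.1 - i.+1 else i - c.1)
    else (if c.1 < i then i - c.1.+1 else c.1 - i)
  else i.

(** Lexicographic induction on [cnt i u] and [dist i u]. Passing a neighbouring puncture lowers the
    distance unless it lowers the count; once the head of [u] is next to [t_i] or [t_i^-1] in the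
    alphabet, [shrink_step] lowers the count. *)
Lemma simple_orbit i u : reduced (conjw u i) -> simple (conjw u i) -> in_orbit (conjw u i).
Proof.
have [N hN] := ubnP (cnt i u); elim: N i u hN => // N IHN i u hN.
have [D hD] := ubnP (dist i u); elim: D i u hN hD => // D IHD i u hN hD hw hs.
have step (f g : 'I_n -> word n) i' u' : in_Bn g -> invw f g -> invw g f -> monotone f ->
    ext f (conjw u i) = conjw u' i' -> reduced (conjw u' i') ->
    (cnt i' u' < cnt i u \/ (cnt i' u' <= cnt i u /\ dist i' u' < dist i u)) ->
    in_orbit (conjw u i).
  move=> hg fg gf hm E hr hlt; apply: (in_orbit_back hg fg hw).
  have hs' : simple (conjw u' i').
    rewrite -E; apply: (simple_ext hm _ hw hs) => v hv; exists (ext g v).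
    by rewrite reduced_ext gf.
  rewrite E; case: hlt => [h|[h1 h2]]; [apply: IHN | apply: IHD] => //; lia.
have hnon : if u is c :: _ then c.1 != i else true.
  by move: hw; clear; case: u => // c x /conjw_head.
have mv (f g : 'I_n -> word n) i' : in_Bn g -> invw f g -> invw g f -> monotone f ->
    subw f [:: (i, true)] = [:: (i', true)] ->
    (forall c, filter (nonidx i') (subw f [:: c]) =
       if c.1 == i then [::] else [:: relabel i i' c]) ->
    (forall u', (if u is c :: _ then exists u2, u' = relabel i i' c :: u2 else u' = [::]) ->
       dist i' u' < dist i u) -> in_orbit (conjw u i).
  move=> hg fg gf hm fi fc hdist.
  have [u' [hr E hle hhead]] := move_step u fi fc.
  apply: (step f g i' u') => //; case: (leqP (cnt i u) (cnt i' u')) => hc; [right|by left].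
  split=> //; apply: hdist; move: hnon (hhead hc).
  by case: (u) => // c x h1 h2; exact: h2.
have right_ j : j = i.+1 :> nat -> (forall u', (if u is c :: _ then
     exists u2, u' = relabel i j c :: u2 else u' = [::]) -> dist j u' < dist i u) ->
     in_orbit (conjw u i).
  move=> ij; apply: (mv (sig i j) (sigV i j)).
  - exact: in_Bn_sigV.
  - exact: sigK.
  - exact: sigVK.
  - exact: monotone_sig.
  - by rewrite /subw /= /sig eqxx.
  - by move=> c; exact: sig_move.
have left_ j : i = j.+1 :> nat -> (forall u', (if u is c :: _ then
     exists u2, u' = relabel i j c :: u2 else u' = [::]) -> dist j u' < dist i u) ->
     in_orbit (conjw u i).
  move=> ij; apply: (mv (sigV j i) (sig j i)).
  - exact: in_Bn_sig.
  - exact: sigVK.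
  - exact: sigK.
  - exact: monotone_sigV.
  - by rewrite /subw /= /sigV eqxx.
  - by move=> c; exact: sigV_move.
have predo : 0 < i -> exists j, i = j.+1 :> nat.
  move=> hi; have hj : i.-1 < n by have := ltn_ord i; lia.
  by exists (Ordinal hj) => /=; lia.
have arcs := arcs_of_simple hw hs.
case: u hN hD hw hs step hnon mv right_ left_ arcs => [|c u] hN hD hw hs step ci mv right_ left_ arcs.
  case: (posnP i) => [i0|ipos].
    exists (@gen n); split; first exact: in_Bn_gen.
    by rewrite extE subw_genid; congr [:: (_, _)]; apply: val_inj.
  have [j ij] := predo ipos.
  by apply: (left_ j ij) => u' ->; rewrite /dist ij.
have hci : nat_of_ord c.1 <> i by move/val_inj => E; rewrite E eqxx in ci.
have rel j u' : (exists u2, u' = relabel i j c :: u2) ->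
    dist j u' = dist j [:: (if c.1 == j then i else c.1, c.2)].
  case=> u2 ->; rewrite /relabel; case: tpermP => [E|->|_ /eqP/negbTE -> //].
    by rewrite E eqxx in ci.
  by rewrite eqxx.
have hl := ltn_ord c.1; have hi := ltn_ord i.
(* The excluded head [t_(i+1)] directly follows [t_i^-1] in the alphabet and is left to
   [shrink_step]. A head [t_(i+1)^-1] is passed: the puncture must reach the other side of that
   ray. *)
have goR : i < c.1 -> (c.2 -> i.+1 < c.1) -> in_orbit (conjw (c :: u) i).
  move=> hlt h2; have hj : i.+1 < n by lia.
  apply: (right_ (Ordinal hj)) => // u' /rel ->; rewrite /dist /=.
  case: eqP => [E|ne]; last first.
    have {}ne : nat_of_ord c.1 <> i.+1 by move=> E; apply: ne; exact: val_inj.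
    by move: h2; case: c.2 => h2 /=; do ![case: ifP => ?]; lia.
  have {}E : nat_of_ord c.1 = i.+1 by rewrite E.
  by move: h2; case: c.2 => h2 /=; do ![case: ifP => ?]; lia.
have goL : c.1 < i -> (~~ c.2 -> c.1.+1 < i) -> in_orbit (conjw (c :: u) i).
  move=> hlt h2; have [|j ij] := predo; first by lia.
  apply: (left_ j) => // u' /rel ->; rewrite /dist /=.
  case: eqP => [E|ne]; last first.
    have {}ne : nat_of_ord c.1 <> j by move=> E; apply: ne; exact: val_inj.
    by move: h2; case: c.2 => h2 /=; do ![case: ifP => ?]; lia.
  by move: h2; rewrite E; case: c.2 => h2 /=; do ![case: ifP => ?]; lia.
case: (ltngtP c.1 i) => [hlt|hlt|//].
  case: (boolP (~~ c.2 && (i == c.1.+1 :> nat))) => [/andP[c2 /eqP E]|h]; last first.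
    by apply: goL => // c2; move: h; rewrite c2 /=; lia.
  have [nij nji] := ord_neq_succ E.
  have Ec : c = (c.1, false) by rewrite [LHS]surjective_pairing (negbTE c2).
  (* The head [t_(i-1)^-1] directly precedes [t_i], whence [a = t_i^-1]; the case of [t_(i+1)] below
     is its mirror image. *)
  have [||||c' h1 h2|u' [h1 h2 h3]] :=
    @shrink_step (sig c.1 i) i (i, false) c u hw erefl ci.
  - exact/negbTE.
  - by apply: follows_center => //=; rewrite Ec /linv /rank /=; lia.
  - by rewrite {2}Ec /subw /= /sig eqxx.
  - by rewrite [in RHS]Ec /subw /= /sig nji eqxx.
  - by case: c' h1 h2 => k [] /= h1 h2; rewrite /subw /= /sig (negbTE h1) (negbTE h2).
  apply: (step (sig c.1 i) (sigV c.1 i) c.1 u') => //; last by left.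
  - exact: in_Bn_sigV.
  - exact: sigK.
  - exact: sigVK.
  - exact: monotone_sig.
case: (boolP (c.2 && (c.1 == i.+1 :> nat))) => [/andP[c2 /eqP E]|h]; last first.
  by apply: goR => // c2; move: h; rewrite c2 /=; lia.
have [nij nji] := ord_neq_succ E.
have Ec : c = (c.1, true) by rewrite [LHS]surjective_pairing c2.
have [||||c' h1 h2|u' [h1 h2 h3]] :=
  @shrink_step (sigV i c.1) i (i, true) c u hw erefl ci.
- exact: c2.
- by apply: follows_center => //=; rewrite Ec /linv /rank /=; lia.
- by rewrite {2}Ec /subw /= /sigV eqxx.
- by rewrite [in RHS]Ec /subw /= /sigV nij eqxx.
- by case: c' h1 h2 => k [] /= h1 h2; rewrite /subw /= /sigV (negbTE h1) (negbTE h2).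
apply: (step (sigV i c.1) (sig i c.1) c.1 u') => //; last by left.
- exact: in_Bn_sig.
- exact: sigVK.
- exact: sigK.
- exact: monotone_sigV.
Qed.

End First.
End Main.

Theorem theoremA (n : nat) (hn : 0 < n) (w : word n) (hw : reduced w) :
  (exists f : 'I_n -> word n, in_Bn f /\ ext f (gen (Ordinal hn)) = w) <->
  ((exists i : 'I_n, cyc_red w = gen i) /\ planar_word w).
Proof.
rewrite /planar_word (reduce_id hw); split.
  move=> [f [hf E]]; split.
    have [s [u [hr hu]]] := in_Bn_conjw hf (Ordinal hn); exists s.
    have -> : w = conjw u s by rewrite -E extE subw_gen hu reduce_id.
    exact: cred_conjw.
  apply: planar_of_arcs => //; apply: arcs_of_simple => //; rewrite -E.
  have hm := in_Bn_monotone hf; case: hf => -[_ fs] _ _.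
  apply: simple_ext => //; exact: simple_t1.
move=> [[i /cred_eq_gen [u Ew]] hp].
have := simple_of_arcs hw (arcs_of_planar hw hp).
by move: hw; rewrite Ew => hw' hs; apply: simple_orbit.
Qed.
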